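(* Fix an integer $n>1$ and let $f_n:[1,2n+1]\to[1,2n+1]$ be the continuous function with $f_n(1)=n+1$, $f_n(2)=2n+1$, $f_n(n+1)=n+2$, $f_n(n+2)=n$, $f_n(2n+1)=1$, which is affine on each of the intervals $[1,2]$, $[2,n+1]$, $[n+1,n+2]$, $[n+2,2n+1]$. Then: (a) for every positive integer $k$, the equation $f_n^k(x)=x$ has exactly $c_{k,n}$ distinct solutions in $[1,2n+1]$; (b) for every positive integer $m$, $f_n$ has exactly $\Phi_n(m)/m$ distinct periodic orbits of minimal period $m$; (c) $\lim_{m\to\infty}\frac{1}{m}\log\big(\Phi_n(m)/m\big)=\log\lambda_n$, where $\lambda_n$ is the unique positive zero (which is also the zero of largest absolute value) of the polynomial $x^{2n+1}-2x^{2n-1}-1$.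
   Context: Fix $n>1$. Let $Q_n=\{(1,n+1)\}\cup\{(m,2n+2-m):2\le m\le n\}\cup\{(m,2n+1-m):n+1\le m\le 2n\}$. For integers $1\le i,j\le 2n$ and $k\ge1$ define $b_{k,i,j,n}$ recursively by $b_{1,i,j,n}=1$ if $(i,j)\in Q_n$ and $0$ otherwise, and $b_{k+1,i,j,n}=b_{k,i,2n+1-j,n}+b_{k,i,n+1,n}$ if $1\le j\le n-1$; $b_{k+1,i,n,n}=b_{k,i,n,n}+b_{k,i,n+1,n}$; $b_{k+1,i,n+1,n}=b_{k,i,1,n}$; $b_{k+1,i,j,n}=b_{k,i,2n+2-j,n}$ if $n+2\le j\le 2n$. Define $c_{k,n}=\sum_{i=1}^{2n}b_{k,i,i,n}+b_{k,n+1,n,n}+\sum_{i=n+2}^{2n}b_{k,i,n+1,n}$. For an integer-valued function $\phi$ on the positive integers, $\Phi(m,\phi)=\sum_{d\mid m}\mu(m/d)\phi(d)$ ($\mu$ the Möbius function); equivalently $\Phi(1,\phi)=\phi(1)$ and for $m=p_1^{k_1}\cdots p_r^{k_r}$ (distinct primes) $\Phi(m,\phi)=\phi(m)-\sum_i\phi(m/p_i)+\sum_{i_1<i_2}\phi(m/(p_{i_1}p_{i_2}))-\cdots+(-1)^r\phi(m/(p_1\cdots p_r))$. Set $\phi_n(k)=c_{k,n}$ and $\Phi_n(m)=\Phi(m,\phi_n)$. Minimal period $m$ of a point $x$: $f^m(x)=x$ and the orbit of $x$ has exactly $m$ elements. *)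

(* Defs.v *)
From Stdlib Require Import Reals ZArith List.
From mathcomp Require Import all_boot.

Set Implicit Arguments.
Unset Strict Implicit.

Definition b1 (i j n : nat) : nat :=
  [|| (i == 1) && (j == n + 1),
      [&& 2 <= i, i <= n & j == 2 * n + 2 - i]
    | [&& n + 1 <= i, i <= 2 * n & j == 2 * n + 1 - i]].

(* b k i j n = b_{k,i,j,n} for k >= 1 (the value at k = 0 is irrelevant). *)
Fixpoint b (k i j n : nat) {struct k} : nat :=
  match k with
  | 0 => 0
  | 1 => b1 i j n
  | S k' =>
      if (1 <= j) && (j <= n - 1) then b k' i (2 * n + 1 - j) n + b k' i (n + 1) n
      else if j == n then b k' i n n + b k' i (n + 1) n
      else if j == n + 1 then b k' i 1 n
      else if (n + 2 <= j) && (j <= 2 * n) then b k' i (2 * n + 2 - j) n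
      else 0
  end.

Definition c (k n : nat) : nat :=
  \sum_(1 <= i < 2 * n + 1) b k i i n + b k (n + 1) n n
  + \sum_(n + 2 <= i < 2 * n + 1) b k i (n + 1) n.

Definition moebius (m : nat) : Z :=
  if m == 0 then 0%Z
  else if all (fun p => logn p m == 1) (primes m)
       then Z.pow (-1)%Z (Z.of_nat (size (primes m)))
       else 0%Z.

Definition Phi (m : nat) (phi : nat -> Z) : Z :=
  foldr (fun d acc => (moebius (m %/ d) * phi d + acc)%Z) 0%Z (divisors m).

Definition phi_n (n : nat) : nat -> Z := fun k => Z.of_nat (c k n).
Definition Phi_n (n m : nat) : Z := Phi m (phi_n n).

Open Scope R_scope.

Definition affine (x0 y0 x1 y1 x : R) : R :=
  y0 + (y1 - y0) / (x1 - x0) * (x - x0).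

(* f_n on [1,2n+1]: affine on [1,2], [2,n+1], [n+1,n+2], [n+2,2n+1] with
   f(1)=n+1, f(2)=2n+1, f(n+1)=n+2, f(n+2)=n, f(2n+1)=1.
   (Values outside [1,2n+1] are irrelevant: we only consider points of
   [1,2n+1], which is invariant.) *)
Definition f_n (n : nat) (x : R) : R :=
  let N := INR n in
  if Rle_dec x 2 then affine 1 (N + 1) 2 (2 * N + 1) x
  else if Rle_dec x (N + 1) then affine 2 (2 * N + 1) (N + 1) (N + 2) x
  else if Rle_dec x (N + 2) then affine (N + 1) (N + 2) (N + 2) N x
  else affine (N + 2) N (2 * N + 1) 1 x.

Fixpoint iterR (k : nat) (g : R -> R) (x : R) : R :=
  match k with
  | 0 => x
  | S k' => g (iterR k' g x)
  end.

Definition in_dom (n : nat) (x : R) : Prop := 1 <= x <= 2 * INR n + 1.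

Definition orbit_list (g : R -> R) (x : R) (m : nat) : list R :=
  List.map (fun j => iterR j g x) (List.seq 0 m).

Definition minimal_period (g : R -> R) (m : nat) (x : R) : Prop :=
  iterR m g x = x /\ List.NoDup (orbit_list g x m).

Definition orbit_rel (g : R -> R) (x y : R) : Prop := exists j, iterR j g x = y.

Definition Cmul (z w : R * R) : R * R :=
  (fst z * fst w - snd z * snd w, fst z * snd w + snd z * fst w).
Fixpoint Cpow (z : R * R) (k : nat) : R * R :=
  match k with 0 => (1, 0) | S k' => Cmul z (Cpow z k') end.
Definition Cabs (z : R * R) : R := sqrt (fst z * fst z + snd z * snd z).

Definition P_n_C (n : nat) (z : R * R) : R * R :=
  (fst (Cpow z (2 * n + 1)) - 2 * fst (Cpow z (2 * n - 1)) - 1,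
   snd (Cpow z (2 * n + 1)) - 2 * snd (Cpow z (2 * n - 1))).
Definition P_n (n : nat) (x : R) : R := x ^ (2 * n + 1) - 2 * x ^ (2 * n - 1) - 1.

Close Scope R_scope.

(* Main.v *)
Require Import Defs.
From HB Require Import structures.
From Stdlib Require Import Reals ZArith List Classical Lra Psatz.
From mathcomp Require Import all_boot.
From mathcomp Require Import zify.

(* The integer points cut the domain into [2n] cells [I_i = [i, i+1]], and [f_n]
   is affine on each cell and maps it onto a union of cells. Every closed walk of
   length [k] in the resulting Markov graph gives an affine branch of [f_n^k] of
   slope at least 2 in absolute value, hence exactly one fixed point of [f_n^k];
   assigning the integer points to cells suitably makes this a bijection between
   closed walks and fixed points. The closed walks are counted by [c], because
   [b] counts walks up to merging adjacent target cells. Moebius inversion then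
   counts the points of minimal period [m], which split into orbits of size [m].
   For the growth rate, the recursion for [b] has an explicit positive left
   eigenvector whose eigenvalue [l] is the positive zero of the polynomial, so [c k n]
   lies between two constant multiples of [l^k], and the contribution of the proper
   divisors to [Phi_n n m] is only of order [m l^(m/2)]. *)

(** * Closed walks in the Markov graph *)

(** There is an edge when [j, j+1] lies in the image of [i, i+1]: cell [1] is stretched over
    [n+1, 2n+1], cell [n + 1] over [n, n+2], and every other cell is flipped onto a single cell. *)
Definition edge (n i j : nat) : bool :=
  [|| (i == 1) && (n + 1 <= j <= 2 * n),
      (2 <= i <= n) && (i + j == 2 * n + 2),
      (i == n + 1) && (n <= j <= n + 1)
    | (n + 2 <= i <= 2 * n) && (i + j == 2 * n + 1)].

Variant edge_spec (n i j : nat) : Prop :=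
| EdgeFirst of i = 1 & n + 1 <= j <= 2 * n
| EdgeLow of 2 <= i <= n & i + j = 2 * n + 2
| EdgeMid of i = n + 1 & n <= j <= n + 1
| EdgeHigh of n + 2 <= i <= 2 * n & i + j = 2 * n + 1.

Lemma edgeP n i j : edge n i j -> edge_spec n i j.
Proof.
case/or4P => /andP[].
- by move/eqP => *; apply: EdgeFirst.
- by move=> ? /eqP ?; apply: EdgeLow.
- by move/eqP => *; apply: EdgeMid.
- by move=> ? /eqP ?; apply: EdgeHigh.
Qed.

Definition preds (n j : nat) : seq nat :=
  if j < n then [:: 2 * n + 1 - j] else if j == n then [:: n + 1]
  else if j == n + 1 then [:: 1; n + 1] else [:: 1; 2 * n + 2 - j].

Lemma mem_preds n i j : 1 < n -> 1 <= j <= 2 * n -> (i \in preds n j) = edge n i j.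
Proof.
rewrite /preds /edge => n1 jn.
by case: ifP => ?; [|case: ifP => ?; [|case: ifP => ?]]; rewrite !inE; lia.
Qed.

Lemma edge_range n i j : 1 < n -> edge n i j -> (1 <= i <= 2 * n) && (1 <= j <= 2 * n).
Proof. by move=> n1 /edgeP[] *; lia. Qed.

Lemma uniq_preds n j : 1 < n -> j <= 2 * n -> uniq (preds n j).
Proof.
rewrite /preds => n1 jn.
by case: ifP => ?; [|case: ifP => ?; [|case: ifP => ?]]; rewrite //= !inE; lia.
Qed.

(** A walk is stored without its start [i], to fit [path], and grows at its end, because the
    recursion for [b] acts on the final index. *)
Fixpoint walks (n k i j : nat) : seq (seq nat) :=
  if k is k'.+1 then [seq rcons w j | l <- preds n j, w <- walks n k' i l]
  else if i == j then [:: [::]] else [::].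

Lemma mem_walks n k i j w : 1 < n -> 1 <= i <= 2 * n -> 1 <= j <= 2 * n ->
  (w \in walks n k i j) = [&& size w == k, path (edge n) i w & last i w == j].
Proof.
move=> n1 ir; elim: k j w => [|k IH] j w jr /=.
  by case: w => [|x w]; case: eqP => //= ->; rewrite ?eqxx.
apply/allpairsPdep/idP.
- case=> l [w' [lp]]; rewrite mem_preds // in lp.
  have /andP[lr _] := edge_range _ _ _ n1 lp.
  rewrite IH // => /and3P[/eqP sw pw /eqP lw] ->.
  by rewrite size_rcons sw eqxx last_rcons eqxx rcons_path pw lw lp.
- case: (lastP w) => [|w' x] //; rewrite size_rcons eqSS last_rcons rcons_path.
  case/and3P => sw /andP[pw lx] /eqP xj; rewrite xj in lx *.
  have /andP[lr _] := edge_range _ _ _ n1 lx.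
  by exists (last i w'), w'; rewrite mem_preds ?IH ?sw ?pw ?eqxx.
Qed.

Lemma uniq_walks n k i j : 1 < n -> 1 <= i <= 2 * n -> 1 <= j <= 2 * n ->
  uniq (walks n k i j).
Proof.
move=> n1 ir; elim: k j => [|k IH] j jr /=; first by case: ifP.
have predsr l : l \in preds n j -> 1 <= l <= 2 * n.
  by rewrite mem_preds // => /(edge_range _ _ _ n1)/andP[].
apply: allpairs_uniq_dep.
- by apply: uniq_preds; lia.
- by move=> l /predsr; apply: IH.
- move=> _ _ /allpairsPdep[x [u [xp up ->]]] /allpairsPdep[y [v [yp vp ->]]] /=.
  move=> /rcons_inj[uv]; rewrite -{}uv in vp *.
  have [xr yr] := (predsr _ xp, predsr _ yp).
  move: up vp; rewrite (mem_walks n k i x) // (mem_walks n k i y) //.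
  by case/and3P => _ _ /eqP -> /and3P[_ _ /eqP ->].
Qed.

Lemma size_walksS n k i j :
  size (walks n k.+1 i j) = sumn [seq size (walks n k i l) | l <- preds n j].
Proof. by rewrite [walks _ _ _ _]/= size_allpairs_dep. Qed.

Lemma bS_low k i j n : 1 <= j < n ->
  b k.+2 i j n = b k.+1 i (2 * n + 1 - j) n + b k.+1 i (n + 1) n.
Proof. by move=> jr; rewrite [LHS]/=; do ![case: ifP => ? //]; lia. Qed.

Lemma bS_n k i n : 1 < n -> b k.+2 i n n = b k.+1 i n n + b k.+1 i (n + 1) n.
Proof. by move=> n1; rewrite [LHS]/=; do ![case: ifP => ? //]; lia. Qed.

Lemma bS_n1 k i n : b k.+2 i (n + 1) n = b k.+1 i 1 n.
Proof. by rewrite [LHS]/=; do ![case: ifP => ? //]; lia. Qed.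

Lemma bS_high k i j n : n + 2 <= j <= 2 * n -> b k.+2 i j n = b k.+1 i (2 * n + 2 - j) n.
Proof. by move=> jr; rewrite [LHS]/=; do ![case: ifP => ? //]; lia. Qed.

Arguments b : simpl never.

(* The index [j] of [b] stands for the interval [[j, j+1]], except that [n] stands for
   [[n, n+2]] and [n+1] for [[n+1, 2n+1]]; hence the correction terms. *)
Lemma size_walks n k i j : 1 < n -> 1 <= i <= 2 * n -> 1 <= j <= 2 * n ->
  size (walks n k.+1 i j) =
    b k.+1 i j n + (if j == n + 1 then b k.+1 i n n
                    else if n + 2 <= j then b k.+1 i (n + 1) n else 0).
Proof.
move=> n1 ir; elim: k j => [|k IH] j jr; rewrite size_walksS.
  have sz0 l : size (walks n 0 i l) = (i == l) by rewrite /=; case: ifP.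
  have b_1 m : b 1 i m n = b1 i m n by [].
  rewrite (eq_map sz0) !b_1 /preds /b1.
  by do ![case: ifP => ?]; rewrite /=; lia.
have IHp : [seq size (walks n k.+1 i l) | l <- preds n j] =
  [seq b k.+1 i l n + (if l == n + 1 then b k.+1 i n n
                    else if n + 2 <= l then b k.+1 i (n + 1) n else 0) | l <- preds n j].
  apply/eq_in_map => l; rewrite mem_preds // => /(edge_range _ _ _ n1)/andP[lr _].
  exact: IH.
rewrite IHp {IH IHp} /preds.
case: ifP => [jl|nl]; [|case: eqP => [{j jr nl}->|jn]; [|case: eqP => [{j jr jn nl}->|jn1]]].
- have [-> ->] : (j == n + 1) = false /\ (n + 2 <= j) = false by lia.
  rewrite bS_low /= ?addn0; last lia.
  by congr (_ + _); do ![case: ifP => ? //]; (try congr b); lia.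
- have [-> ->] : (n == n + 1) = false /\ (n + 2 <= n) = false by lia.
  by rewrite bS_n // /= eqxx !addn0 addnC.
- have [e1 e2] : (1 == n + 1) = false /\ (n + 2 <= 1) = false by lia.
  by rewrite bS_n1 bS_n // /= eqxx e1 e2 !addn0; congr (_ + _); rewrite addnC.
- have [e1 e2] : (1 == n + 1) = false /\ (n + 2 <= 1) = false by lia.
  have [e3 e4] : (2 * n + 2 - j == n + 1) = false /\ (n + 2 <= 2 * n + 2 - j) = false by lia.
  have -> : n + 2 <= j by lia.
  rewrite bS_high ?bS_n1 /= ?e1 ?e2 ?e3 ?e4 ?addn0; last lia.
  by rewrite addnC.
Qed.

Definition closed_walks (n k : nat) : seq (nat * seq nat) :=
  [seq (i, w) | i <- index_iota 1 (2 * n + 1), w <- walks n k i i].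

Lemma mem_closed_walks n k i w : 1 < n ->
  ((i, w) \in closed_walks n k) =
    [&& 1 <= i <= 2 * n, size w == k, path (edge n) i w & last i w == i].
Proof.
move=> n1; apply/allpairsPdep/idP.
  case=> i' [w' []]; rewrite mem_index_iota => ir ww [-> ->].
  have ir' : 1 <= i' <= 2 * n by lia.
  by rewrite ir' /= -mem_walks.
case/andP => ir ww; exists i, w; rewrite mem_index_iota mem_walks //; split => //; lia.
Qed.

Lemma uniq_closed_walks n k : 1 < n -> uniq (closed_walks n k).
Proof.
move=> n1; apply: allpairs_uniq_dep.
- exact: iota_uniq.
- by move=> i; rewrite mem_index_iota => ir; apply: uniq_walks => //; lia.
- move=> _ _ /allpairsPdep[i [w [_ _ ->]]] /allpairsPdep[j [u [_ _ ->]]] /=.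
  by case=> -> ->.
Qed.

(** On the diagonal, the two correction terms of [size_walks] become the two extra terms in the
    definition of [c]. *)
Lemma size_closed_walks n k : 1 < n -> size (closed_walks n k.+1) = c k.+1 n.
Proof.
move=> n1; rewrite size_allpairs_dep sumnE big_map /c.
rewrite (eq_big_seq (fun i => b k.+1 i i n +
  ((if i == n + 1 then b k.+1 i n n else 0) +
   (if n + 2 <= i then b k.+1 i (n + 1) n else 0)))); last first.
  move=> i; rewrite mem_index_iota => ir; rewrite size_walks //; try lia.
  by congr (_ + _); do ![case: ifP => ? //]; lia.
rewrite !big_split /= -addnA; congr (_ + (_ + _)).
- rewrite -big_mkcond /=.
  rewrite (@big_cat_nat _ _ _ (n + 1)) /=; [|lia..].
  rewrite big_nat_cond big1 ?add0n; last by move=> i; lia.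
  rewrite big_ltn_cond ?eqxx /=; last lia.
  by rewrite big_nat_cond big1 ?addn0 // => i; lia.
- rewrite -big_mkcond /= (@big_cat_nat _ _ _ (n + 2)) /=; [|lia..].
  rewrite big_nat_cond big1 ?add0n; last by move=> i; lia.
  by rewrite big_nat_cond [RHS]big_nat_cond; apply: eq_bigl => i; lia.
Qed.

(** * Moebius inversion and periodic orbits *)

(** Sums over [Z] can then be split, reindexed and exchanged as big operators. *)
HB.instance Definition _ :=
  Monoid.isComLaw.Build Z 0%Z Z.add Z.add_assoc Z.add_comm Z.add_0_l.

Lemma PhiE m phi :
  Phi m phi = \big[Z.add/0%Z]_(d <- divisors m) (moebius (m %/ d) * phi d)%Z.
Proof. by rewrite unlock. Qed.

(** Multiplying by [p] creates a square factor when [p] divides [e], and otherwise adds just one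
    prime. *)
Lemma moebius_mul_prime p e : prime p -> 0 < e ->
  moebius (p * e) = if p %| e then 0%Z else (- moebius e)%Z.
Proof.
move=> pp e0; have p0 := prime_gt0 pp.
have [pe0 e0'] : (p * e == 0) = false /\ (e == 0) = false by split; nia.
rewrite /moebius pe0 e0'.
have lp q : logn q (p * e) = (q == p) + logn q e by rewrite lognM // logn_prime.
case pe: (p %| e).
  case: allP => // /(_ p); rewrite primesM // primes_prime // inE eqxx => /(_ isT).
  by rewrite lp eqxx; move: pe; rewrite -{1}(expn1 p) pfactor_dvdn //; lia.
have pP : perm_eq (primes (p * e)) (p :: primes e).
  apply: uniq_perm; first exact: primes_uniq.
    by rewrite /= primes_uniq mem_primes pe !andbF.
  by move=> q; rewrite primesM // primes_prime // !inE.
rewrite (perm_all _ pP) (perm_size pP) [size _]/= Nat2Z.inj_succ Z.pow_succ_r; last lia.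
rewrite [all _ (p :: _)]/= lp eqxx lognE pe !andbF addn0 andTb.
rewrite (_ : all _ (primes e) = all (fun q => logn q e == 1) (primes e)); last first.
  apply: eq_in_all => q; rewrite lp; have [->|//] := eqVneq q p.
  by rewrite mem_primes pe !andbF.
by case: ifP => _ //; lia.
Qed.

(** For a prime [p] with N = pM, the divisors divisible by [p] are the pe with e | M. Such a term
    vanishes if [p] divides [e], and otherwise cancels against the term of the divisor [e]. *)
Lemma sum_moebius N : 0 < N ->
  \big[Z.add/0%Z]_(d <- divisors N) moebius d = if N == 1 then 1%Z else 0%Z.
Proof.
move=> N0; case: eqP => [->|N1]; first by rewrite big_seq1.
have [p pp pN] : exists2 p, prime p & p %| N.
  by exists (pdiv N); rewrite ?pdiv_dvd ?pdiv_prime //; lia.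
have p0 := prime_gt0 pp.
have [M NM] : exists M, N = p * M by case/dvdnP: pN => M ->; exists M; rewrite mulnC.
have M0 : 0 < M by lia.
have multiples : perm_eq [seq d <- divisors N | p %| d] [seq p * e | e <- divisors M].
  apply: uniq_perm; first by rewrite filter_uniq ?divisors_uniq.
    by rewrite map_inj_uniq ?divisors_uniq // => x y; nia.
  move=> d; rewrite mem_filter -dvdn_divisors //; apply/andP/mapP.
    case=> /dvdnP[e ->]; rewrite mulnC NM dvdn_pmul2l // => eM.
    by exists e; rewrite -?dvdn_divisors.
  by case=> e; rewrite -dvdn_divisors // => eM ->; rewrite dvdn_mulr // NM dvdn_pmul2l.
have others : perm_eq [seq d <- divisors N | ~~ (p %| d)] [seq d <- divisors M | ~~ (p %| d)].
  apply: uniq_perm; rewrite ?filter_uniq ?divisors_uniq // => d.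
  rewrite !mem_filter -!dvdn_divisors //; case pd: (p %| d) => //=.
  by rewrite NM Gauss_dvdr // coprime_sym prime_coprime ?pd.
rewrite (bigID (dvdn p)) /= -big_filter (perm_big _ multiples) /= big_map.
rewrite -[X in Z.add _ X]big_filter (perm_big _ others) /= big_filter.
rewrite (eq_big_seq (fun e => if ~~ (p %| e) then (- moebius e)%Z else 0%Z)); last first.
  move=> e; rewrite -dvdn_divisors // => eM.
  by rewrite moebius_mul_prime ?(dvdn_gt0 M0) //; case: ifP.
rewrite -big_mkcond /= -(big_morph Z.opp Z.opp_add_distr (erefl : Z.opp 0 = 0%Z)).
lia.
Qed.

(** This sum is the contribution to [Phi m] of one point of exact period [p]. As [d] runs through
    the multiples of [p] dividing [m], the quotient [m %/ d] runs through the divisors of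
    [m %/ p]. *)
Lemma sum_moebius_multiples m p : 0 < m -> p %| m ->
  \big[Z.add/0%Z]_(d <- divisors m) (moebius (m %/ d) * (if p %| d then 1 else 0))%Z =
    if p == m then 1%Z else 0%Z.
Proof.
move=> m0 pm; have p0 := dvdn_gt0 m0 pm.
have [q mq] : exists q, m = q * p by case/dvdnP: pm => q ->; exists q.
have q0 : 0 < q by lia.
rewrite (eq_bigr (fun d => if p %| d then moebius (m %/ d) else 0%Z)); last first.
  by move=> d _; case: ifP => _; lia.
rewrite -big_mkcond -big_filter /= -(big_map (fun d => m %/ d) predT moebius).
have P : perm_eq [seq m %/ d | d <- divisors m & p %| d] (divisors q).
  apply: uniq_perm; last 2 first.
  - exact: divisors_uniq.
  - move=> e; rewrite -dvdn_divisors //; apply/mapP/idP.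
      case=> d; rewrite mem_filter -dvdn_divisors // => /andP[/dvdnP[k ->] km] ->.
      move: km; rewrite mq dvdn_pmul2r // => kq.
      rewrite divnMr // -{2}(divnK kq); exact: dvdn_mulr.
    move=> eq; exists (q %/ e * p).
      by rewrite mem_filter dvdn_mull // -dvdn_divisors // mq dvdn_pmul2r // dvdn_div.
    by rewrite mq divnMr // divnA // mulKn.
  - rewrite map_inj_in_uniq ?filter_uniq ?divisors_uniq // => x y.
    rewrite !mem_filter -!dvdn_divisors // => /andP[_ xm] /andP[_ ym] e.
    have my : 0 < m %/ y by rewrite divn_gt0; [apply: dvdn_leq | apply: dvdn_gt0 ym].
    have := divnK xm; rewrite e -{2}(divnK ym) => /eqP.
    by rewrite eqn_pmul2l // => /eqP.
rewrite (perm_big _ P) /= sum_moebius //.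
by congr (if _ then _ else _); apply/eqP/eqP; nia.
Qed.

Lemma periodE (T : eqType) (g : T -> T) (m : nat) (x : T) : 0 < m -> iter m g x = x ->
  exists p, [/\ 0 < p, p %| m & forall d, (iter d g x == x) = (p %| d)].
Proof.
move=> m0 gm.
have ex : exists p, (0 < p) && (iter p g x == x) by exists m; rewrite m0 gm eqxx.
case: (ex_minnP ex) => p /andP[p0 /eqP gp] minp.
have mult k : iter (k * p) g x = x by elim: k => // k IH; rewrite mulSn iterD IH.
have H d : (iter d g x == x) = (p %| d).
  rewrite {1}(divn_eq d p) addnC iterD mult /dvdn.
  case: (posnP (d %% p)) => [->|r0]; first by rewrite eqxx.
  apply/negbTE/negP => gr; have := minp (d %% p); rewrite r0 gr => /(_ isT).
  by rewrite leqNgt ltn_mod p0.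
by exists p; split=> //; rewrite -H gm.
Qed.

Lemma uniq_traject_period (T : eqType) (g : T -> T) (m p : nat) (x : T) :
  0 < p -> p %| m -> 0 < m -> (forall d, (iter d g x == x) = (p %| d)) ->
  uniq (traject g x m) = (p == m).
Proof.
move=> p0 pm m0 H; apply/idP/eqP => [u|<-].
  apply/eqP; rewrite eqn_leq dvdn_leq //= leqNgt; apply/negP => lt.
  have := nth_uniq x (s := traject g x m) _ _ u; rewrite size_traject => /(_ 0 p m0 lt).
  by rewrite !nth_traject //= eq_sym H dvdnn; case: p p0 {H pm lt}.
have e : forall i j, i < p -> j < p -> i <= j -> iter i g x = iter j g x -> i = j.
  move=> i j ip jp ij eij.
  (* Running both sides [p - j] steps further shows a return to [x] after p - (j - i) steps; this
     number is positive and at most [p], and it is a multiple of [p] only if [i = j]. *)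
  have : iter (p - j + i) g x == x by rewrite iterD eij -iterD subnK ?H ?dvdnn // ltnW.
  rewrite H => /dvdn_leq; lia.
apply/(uniqP x) => i j; rewrite !inE size_traject => ip jp; rewrite !nth_traject //.
by case/orP: (leq_total i j) => ij E; [|symmetry]; apply: e.
Qed.

(** [F d] stands for the fixed points of [iter d g] in a domain; the lists are compared only at
    points already in one of them, since membership also means lying in the domain. Each [phi d] is
    written as a sum of indicators over [F m]; after exchanging the sums, each point contributes 1
    or 0 by [sum_moebius_multiples]. *)
Lemma Phi_count (T : eqType) (g : T -> T) (F : nat -> seq T) (phi : nat -> nat) (m : nat) :
  0 < m -> (forall d, 0 < d -> uniq (F d) /\ size (F d) = phi d) ->
  (forall d e x, 0 < d -> 0 < e -> x \in F d -> (x \in F e) = (iter e g x == x)) ->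
  Phi m (fun d => Z.of_nat (phi d)) = Z.of_nat (count (fun x => uniq (traject g x m)) (F m)).
Proof.
move=> m0 FU FM; rewrite PhiE.
have szF d : d \in divisors m -> Z.of_nat (phi d) =
    \big[Z.add/0%Z]_(x <- F m) (if iter d g x == x then 1 else 0)%Z.
  rewrite -dvdn_divisors // => dm; have d0 := dvdn_gt0 m0 dm.
  have P : perm_eq (F d) [seq x <- F m | iter d g x == x].
    apply: uniq_perm; [exact: (FU d d0).1 | by rewrite filter_uniq // (FU m m0).1 |].
    move=> x; rewrite mem_filter; apply/idP/andP => [xd|[gd xm]]; last by rewrite (FM m).
    have gd := FM d d x d0 d0 xd; rewrite xd in gd; rewrite -gd (FM d) //; split=> //.
    case/dvdnP: dm => k ->; elim: k => [|k IH]; first exact: eqxx.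
    by rewrite mulSn iterD (eqP IH) -gd.
  rewrite -(FU _ d0).2 (perm_size P) size_filter.
  elim: (F m) => [|x s IH]; first by rewrite big_nil.
  by rewrite big_cons -IH /=; case: ifP => _; lia.
rewrite (eq_big_seq (fun d => \big[Z.add/0%Z]_(x <- F m)
    (moebius (m %/ d) * (if iter d g x == x then 1 else 0))%Z)); last first.
  move=> d dm; rewrite szF // (big_morph (Z.mul (moebius (m %/ d)))
    (Z.mul_add_distr_l (moebius (m %/ d))) (Z.mul_0_r _)) //.
rewrite exchange_big /=.
rewrite (eq_big_seq (fun x => if uniq (traject g x m) then 1 else 0)%Z).
  elim: (F m) => [|x s IH]; first by rewrite big_nil.
  by rewrite big_cons IH /=; case: ifP => _; lia.
move=> x xm; have gx : iter m g x = x by apply/eqP; rewrite -(FM m).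
have [p [p0 pm H]] := periodE _ _ _ _ m0 gx.
rewrite (uniq_traject_period _ _ _ _ _ p0 pm m0 H) -(sum_moebius_multiples _ _ m0 pm).
by apply: eq_bigr => d _; rewrite H.
Qed.

(** Induction on the size of [L]: the first point becomes a representative and its [m] orbit points
    are removed. *)
Lemma orbit_representatives (T : eqType) (g : T -> T) (m : nat) (L : seq T) :
  0 < m -> uniq L ->
  {in L, forall x, [/\ g x \in L, iter m g x = x & uniq (traject g x m)]} ->
  exists reps : seq T,
    [/\ uniq reps, {subset reps <= L},
        {in L, forall x, exists2 r, r \in reps & exists j, iter j g r = x},
        {in reps &, forall r s, (exists j, iter j g r = s) -> r = s}
      & size reps * m = size L].
Proof.
move=> m0; have [k] := ubnP (size L); elim: k L => // k IH [|x L] sL uL HL.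
  by exists [::]; split.
have gL y j : y \in x :: L -> iter j g y \in x :: L.
  by elim: j => //= j IHj yL; have [] := HL _ (IHj yL).
have gm y k' : y \in x :: L -> iter (k' * m) g y = y.
  by move=> yL; have [_ gy _] := HL _ yL; elim: k' => // k' IHk; rewrite mulSn iterD IHk.
have xL : x \in x :: L by rewrite mem_head.
set O := traject g x m.
have inO j : iter j g x \in O.
  rewrite (divn_eq j m) addnC iterD gm //; apply/trajectP.
  by exists (j %% m); rewrite ?ltn_mod.
(* On [L] the iterate [m.-1] inverts [g], so orbits can be followed backwards, and removing one
   leaves an invariant list. *)
have backO y j : y \in x :: L -> iter j g y \in O -> y \in O.
  move=> yL /trajectP[i _ e].
  have <- : iter (j * m.-1 + i) g x = y by rewrite iterD -e -iterD -mulnSr prednK // gm.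
  exact: inO.
pose L' := [seq y <- x :: L | y \notin O].
have uO : uniq O by have [] := HL _ xL.
have sz : size (x :: L) = m + size L'.
  rewrite -(count_predC (mem O)) size_filter; congr (_ + _).
  rewrite -size_filter -[RHS](size_traject g x); apply: perm_size; apply: uniq_perm => //.
    by rewrite filter_uniq.
  move=> y; rewrite mem_filter; apply/andP/idP => [[]//|yO]; split=> //.
  by case/trajectP: yO => i _ ->; apply: gL.
have [|||reps [ureps sub cov dist szr]] := IH L'.
- by rewrite -ltnS (leq_trans _ sL) // sz; lia.
- by rewrite filter_uniq.
- move=> y; rewrite mem_filter => /andP[yO yL]; have [gy my uy] := HL _ yL.
  split=> //; rewrite mem_filter gy andbT; apply: contra yO => gyO.
  exact: (backO y 1).
have repsL r : r \in reps -> r \notin O /\ r \in x :: L.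
  by move/sub; rewrite mem_filter => /andP[].
exists (x :: reps); split.
- by rewrite /= ureps andbT; apply/negP => /repsL[/negP[]]; exact: (inO 0).
- by move=> r; rewrite inE => /orP[/eqP->//|/repsL[]].
- move=> y yL; have [yO|yO] := boolP (y \in O).
    by case/trajectP: yO => i _ ->; exists x; rewrite ?mem_head //; exists i.
  have [|r rr [j e]] := cov y; first by rewrite mem_filter yO.
  by exists r; [rewrite inE rr orbT | exists j].
- move=> r s; rewrite !inE => /orP[/eqP->|rr] /orP[/eqP->|ss] [j e] //.
  + by have [/negP[]] := repsL _ ss; rewrite -e.
  + have [/negP rO rL] := repsL _ rr.
    by case: rO; apply: (backO r j) => //; rewrite e; exact: (inO 0).
  + by apply: dist => //; exists j.
- by rewrite [size (x :: reps)]/= mulSn szr -sz.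
Qed.

(** A point of [F m] with a repetition in its trajectory has a proper divisor of [m] as exact
    period, hence lies in some [F d] with d <= m/2. This crude count gives the lower bound needed
    for the growth rate. *)
Lemma count_aperiodic (T : eqType) (g : T -> T) (F : nat -> seq T) (phi : nat -> nat) (m : nat) :
  0 < m -> (forall d, 0 < d -> uniq (F d) /\ size (F d) = phi d) ->
  (forall d e x, 0 < d -> 0 < e -> x \in F d -> (x \in F e) = (iter e g x == x)) ->
  phi m <= count (fun x => uniq (traject g x m)) (F m) + \sum_(1 <= d < m./2.+1) phi d.
Proof.
move=> m0 FU FM; have [um <-] := FU m m0.
rewrite -(count_predC (fun x => uniq (traject g x m)) (F m)) leq_add2l.
have -> : \sum_(1 <= d < m./2.+1) phi d =
    size (flatten [seq F d | d <- index_iota 1 m./2.+1]).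
  rewrite size_flatten /shape sumnE !big_map; apply: eq_big_seq => d.
  by rewrite mem_index_iota => /andP[d0 _]; rewrite (FU d d0).2.
rewrite -size_filter; apply: uniq_leq_size; first by rewrite filter_uniq.
move=> x; rewrite mem_filter /= => /andP[ux xm].
have gx : iter m g x = x by apply/eqP; rewrite -(FM m).
have [p [p0 pm H]] := periodE _ _ _ _ m0 gx.
apply/flatten_mapP; exists p; last by rewrite (FM m) // H.
move: ux; rewrite (uniq_traject_period _ _ _ _ _ p0 pm m0 H) mem_index_iota p0 /= => pm'.
case/dvdnP: pm pm' m0 {xm gx um} => k -> kp kp0.
rewrite ltnS geq_half_double -muln2 mulnC leq_pmul2r //.
by case: k kp kp0 => [|[|k]] //; rewrite mul1n eqxx.
Qed.

Open Scope R_scope.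

(** * Affine branches and itineraries *)

Lemma leR m n : (m <= n)%N -> INR m <= INR n.
Proof. by move/leP; apply: le_INR. Qed.

Lemma INR_addn m n : INR (m + n)%N = INR m + INR n.
Proof. by rewrite -plusE plus_INR. Qed.

Lemma INR_muln m n : INR (m * n)%N = INR m * INR n.
Proof. by rewrite -multE mult_INR. Qed.

(** Adds the real version of a comparison or equation between naturals, for use by [lra] and
    [nra]. *)
Ltac toR H :=
  let H' := fresh in
  have H' := H;
  first [apply leR in H' | apply (f_equal INR) in H'];
  rewrite ?(INR_addn, INR_muln, S_INR) /= in H'.

Definition slope (n i : nat) : R :=
  if i == 1%N then INR n else if i == (n + 1)%N then -2 else -1.

Definition intercept (n i : nat) : R :=
  if i == 1%N then 1 else if (i <= n)%N then 2 * INR n + 3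
  else if i == (n + 1)%N then 3 * INR n + 4 else 2 * INR n + 2.

(** The affine piece on cell [i] extended to the whole line, so that compositions along walks are
    affine without side conditions. *)
Definition branch (n i : nat) (x : R) : R := slope n i * x + intercept n i.

Definition cell (i : nat) (x : R) : Prop := INR i <= x <= INR i + 1.

(* The endpoints are distributed so that the half-open cells partition the
   domain and the map sends each of them into the union of its successors. *)
Definition hcell (n i : nat) (x : R) : Prop :=
  if (i <= n)%N then INR i <= x < INR i + 1
  else if i == (n + 1)%N then INR i <= x <= INR i + 1
  else INR i < x <= INR i + 1.

Variant branch_spec (n i : nat) (x : R) : Prop :=
| BranchFirst of i = 1%N & branch n i x = INR n * x + 1
| BranchLow of (2 <= i <= n)%N & branch n i x = 2 * INR n + 3 - x
| BranchMid of i = (n + 1)%N & branch n i x = 3 * INR n + 4 - 2 * x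
| BranchHigh of (n + 2 <= i <= 2 * n)%N & branch n i x = 2 * INR n + 2 - x.

Lemma branchP n i x : (1 < n)%N -> (1 <= i <= 2 * n)%N -> branch_spec n i x.
Proof.
move=> n1 ir.
have [i1|[i2|[i3|i4]]] : i = 1%N \/ (2 <= i <= n)%N \/ i = (n + 1)%N \/ (n + 2 <= i <= 2 * n)%N by lia.
- apply: BranchFirst => //; rewrite /branch /slope /intercept.
  by do ![case: ifP => ?]; first [lra | exfalso; lia].
- apply: BranchLow => //; rewrite /branch /slope /intercept.
  by do ![case: ifP => ?]; first [lra | exfalso; lia].
- apply: BranchMid => //; rewrite /branch /slope /intercept.
  by do ![case: ifP => ?]; first [lra | exfalso; lia].
- apply: BranchHigh => //; rewrite /branch /slope /intercept.
  by do ![case: ifP => ?]; first [lra | exfalso; lia].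
Qed.

Lemma f_n_branch n i x : (1 < n)%N -> (1 <= i <= 2 * n)%N -> cell i x ->
  f_n n x = branch n i x.
Proof.
move=> n1 ir; rewrite /cell /f_n /affine => xi; toR n1.
case: (branchP n i x n1 ir) => [i1|/andP[i1 i2]|i1|/andP[i1 i2]] ->; toR i1; try toR i2.
all: repeat (case: Rle_dec => ? /=); try (exfalso; lra).
all: try (field; lra).
(* What remains are breakpoints, where [f_n] selects the piece on the left; there [x] is determined
   and both formulas agree. *)
all: try match goal with H : ?x <= ?a |- context [?x - ?c] =>
  have -> : x = a by lra end; try (field; lra).
Qed.

(** The branch is injective and the image of [cell i] contains [cell j], so no preimage of [cell j]
    lies outside [cell i]. *)
Lemma branch_cell n i j x : (1 < n)%N -> edge n i j -> cell j (branch n i x) -> cell i x.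
Proof.
move=> n1 ij; have /andP[ir jr] := edge_range _ _ _ n1 ij.
move: (branchP n i x n1 ir); case/edgeP: ij => [i1 /andP[j1 j2]|/andP[i1 i2] s|i1 /andP[j1 j2]|/andP[i1 i2] s].
all: case=> [k1|/andP[k1 k2]|k1|/andP[k1 k2]]; try (exfalso; lia).
all: move->; rewrite /cell; toR n1; try toR i1; try toR i2; try toR j1; try toR j2; try toR s; try lra.
all: nra.
Qed.

Fixpoint branches (n i : nat) (w : seq nat) (x : R) : R :=
  if w is j :: w' then branches n j w' (branch n i x) else x.

Fixpoint slopes (n i : nat) (w : seq nat) : R :=
  if w is j :: w' then slope n i * slopes n j w' else 1.

(** [D] is a parameter because orbits are followed both through closed cells and through half-open
    ones. *)
Fixpoint itinerary (D : nat -> R -> Prop) (f : R -> R) (i : nat) (w : seq nat) (x : R) : Prop :=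
  D i x /\ (if w is j :: w' then itinerary D f j w' (f x) else True).

Lemma iterR_Sr k g x : iterR k.+1 g x = iterR k g (g x).
Proof. by elim: k => //= k ->. Qed.

Lemma itinerary_head D f i w x : itinerary D f i w x -> D i x.
Proof. by case: w => [|j w] []. Qed.

Lemma itinerary_last D f i w x : itinerary D f i w x -> D (last i w) (iterR (size w) f x).
Proof. by elim: w i x => [|j w IH] i x []// _ /IH; rewrite iterR_Sr. Qed.

(** Only the final position is assumed to be in its cell; [branch_cell] carries this back along the
    walk. *)
Lemma branches_itinerary n i w x : (1 < n)%N -> path (edge n) i w ->
  cell (last i w) (branches n i w x) ->
  itinerary cell (f_n n) i w x /\ branches n i w x = iterR (size w) (f_n n) x.
Proof.
move=> n1; elim: w i x => [|j w IH] i x //= /andP[ij pw] lw.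
have [it e] := IH _ _ pw lw.
have ci := branch_cell _ _ _ _ n1 ij (itinerary_head _ _ _ _ _ it).
have /andP[ir _] := edge_range _ _ _ n1 ij.
have fb := f_n_branch _ _ _ n1 ir ci.
by rewrite -/(iterR (size w).+1 (f_n n) x) iterR_Sr fb.
Qed.

Lemma itinerary_branches n i w x : (1 < n)%N -> path (edge n) i w ->
  itinerary cell (f_n n) i w x -> branches n i w x = iterR (size w) (f_n n) x.
Proof.
move=> n1; elim: w i x => [|j w IH] i x //= /andP[ij pw] [ci it].
have /andP[ir _] := edge_range _ _ _ n1 ij.
rewrite -/(iterR (size w).+1 (f_n n) x) iterR_Sr -(IH _ _ pw it).
by rewrite (f_n_branch _ i).
Qed.

Lemma branches_affine n i w x : branches n i w x = slopes n i w * x + branches n i w 0.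
Proof.
elim: w i x => [|j w IH] i x /=; first lra.
by rewrite IH (IH _ (branch n i 0)) /branch; lra.
Qed.

(* Decreases by one along every edge of slope [-1]. *)
Definition height (n i : nat) : nat :=
  if (i <= n)%N then (2 * i)%N else (2 * (2 * n + 2 - i) - 1)%N.

Lemma height_edge n i j : edge n i j -> i <> 1%N -> i <> (n + 1)%N ->
  (height n j + 1 = height n i)%N.
Proof. by rewrite /height => /edgeP[] *; do ![case: ifP => ?]; lia. Qed.

(** Departures from the cells [1] and [n + 1] have slope at least 2 in absolute value. A walk with
    no such departure loses one unit of [height] per step, so it cannot be closed unless it is
    empty. *)
Lemma slopes_expand n i w : (1 < n)%N -> path (edge n) i w ->
  1 <= Rabs (slopes n i w) /\
  (2 <= Rabs (slopes n i w) \/ (height n (last i w) + size w <= height n i)%N).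
Proof.
move=> n1; elim: w i => [|j w IH] i /=.
  by rewrite Rabs_R1 addn0; split; [lra|right].
case/andP => ij /IH[h1 h2]; rewrite Rabs_mult.
have [i1|i1] : (i = 1 \/ i = n + 1)%N \/ (i <> 1 /\ i <> n + 1)%N by lia.
  have : 2 <= Rabs (slope n i).
    rewrite /slope; case: i1 => ->; rewrite eqxx; first by toR n1; rewrite Rabs_pos_eq; lra.
    by rewrite ifF; [rewrite Rabs_left; lra | lia].
  by split; [|left]; nra.
have -> : slope n i = -1 by rewrite /slope !ifF //; lia.
have -> : Rabs (-1) = 1 by rewrite Rabs_left; lra.
rewrite Rmult_1_l; split=> //; case: h2 => h2; [by left|right].
by have := height_edge _ _ _ ij i1.1 i1.2; lia.
Qed.

Lemma closed_slopes n i w : (1 < n)%N -> path (edge n) i w -> last i w = i ->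
  w <> [::] -> 2 <= Rabs (slopes n i w).
Proof.
move=> n1 pw lw; case: (slopes_expand _ _ _ n1 pw) => _ []// {pw}.
by rewrite lw; case: w lw => //= j w; lia.
Qed.

Definition fixpoint (n : nat) (iw : nat * seq nat) : R :=
  branches n iw.1 iw.2 0 / (1 - slopes n iw.1 iw.2).

Lemma fixpoint_unique n i w x : (1 < n)%N -> path (edge n) i w -> last i w = i ->
  w <> [::] -> branches n i w x = x <-> x = fixpoint n (i, w).
Proof.
move=> n1 pw lw wn; have S2 := closed_slopes _ _ _ n1 pw lw wn.
rewrite branches_affine /fixpoint /=.
have S1 : 1 - slopes n i w <> 0.
  by move=> e; have s1 : slopes n i w = 1; [lra|]; move: S2; rewrite s1 Rabs_R1 => ?; lra.
split=> [e|->]; last by field.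
apply: (Rmult_eq_reg_r (1 - slopes n i w)) => //.
by rewrite /Rdiv Rmult_assoc Rinv_l //; lra.
Qed.

(** Both ends of [cell i] have preimages [u] and [v] in the cell. With slope S, the fixed point
    satisfies (S - 1)(x - i) = S(u - i), and similarly at the right end; S/(S - 1) is positive since
    |S| >= 2. *)
Lemma cell_fixpoint n i w : (1 < n)%N -> path (edge n) i w -> last i w = i ->
  w <> [::] -> cell i (fixpoint n (i, w)).
Proof.
move=> n1 pw lw wn; have S2 := closed_slopes _ _ _ n1 pw lw wn.
have [x xE] : exists x, x = fixpoint n (i, w) by exists (fixpoint n (i, w)).
have fx : branches n i w x = x by apply/(fixpoint_unique n i w).
rewrite -{}xE.
have S0 : slopes n i w <> 0 by move=> e; move: S2; rewrite e Rabs_R0 => ?; lra.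
have preim y : cell i y -> exists2 u, cell i u & branches n i w u = y.
  move=> cy; exists ((y - branches n i w 0) / slopes n i w); last by rewrite branches_affine; field.
  have e : branches n i w ((y - branches n i w 0) / slopes n i w) = y by rewrite branches_affine; field.
  have : cell (last i w) (branches n i w ((y - branches n i w 0) / slopes n i w)) by rewrite e lw.
  by move/(branches_itinerary _ _ _ _ n1 pw) => [/itinerary_head].
have [u cu eu] := preim (INR i) ltac:(rewrite /cell; lra).
have [v cv ev] := preim (INR i + 1) ltac:(rewrite /cell; lra).
rewrite branches_affine in eu; rewrite branches_affine in ev; rewrite branches_affine in fx.
rewrite /cell in cu cv *.
set S := slopes n i w in S2 S0 fx eu ev *.
have lo : (S - 1) * (x - INR i) = S * (u - INR i) by lra.
have hi : (S - 1) * (INR i + 1 - x) = S * (INR i + 1 - v) by lra.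
by move: S2; rewrite /Rabs; case: Rcase_abs => s S2; split; nra.
Qed.

(** * Integer points and half-open cells *)

Definition is_nat (x : R) : Prop := exists p : nat, x = INR p.

Definition wrong_end (n i : nat) (x : R) : Prop :=
  (i <= n)%N /\ x = INR i + 1 \/ (n + 2 <= i)%N /\ x = INR i.

Lemma hcellP n i x : hcell n i x <-> cell i x /\ ~ wrong_end n i x.
Proof.
rewrite /hcell /cell /wrong_end.
case: ifP => [i1|i1]; [|case: ifP => i2]; split.
- by move=> h; split; [lra|case=> -[? ?]; [lra|lia]].
- by case=> h1 h2; split; [lra|apply: Rnot_le_lt => h3; apply: h2; left; split=> //; lra].
- by move=> h; split; [lra|case=> -[? ?]; lia].
- by case.
- by move=> h; split; [lra|case=> -[? ?]; [lia|lra]].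
- by case=> h1 h2; split; [apply: Rnot_le_lt => h3; apply: h2; right; split; [lia|lra]|lra].
Qed.

Lemma wrong_end_is_nat n i x : wrong_end n i x -> is_nat x.
Proof. by case=> -[_ ->]; [exists i.+1; rewrite S_INR | exists i]. Qed.

Lemma hcell_uniq n i j x : (1 < n)%N -> hcell n i x -> hcell n j x -> i = j.
Proof.
move=> n1; wlog ij : i j / (i <= j)%N.
  by move=> th hi hj; case/orP: (leq_total i j) => ?; [|symmetry]; apply: th.
have [->//|ne hi hj] := eqVneq i j; exfalso.
have {ne ij} [ij|ij] : (i.+1 = j \/ i.+2 <= j)%N by lia.
  have rij : INR j = INR i + 1 by rewrite -ij S_INR.
  by move: hi hj; rewrite /hcell rij; do ![case: ifP => ?]; try lra; lia.
by toR ij; move: hi hj => /hcellP[+ _] /hcellP[+ _]; rewrite /cell; lra.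
Qed.

Lemma hcell_total n x : (1 < n)%N -> in_dom n x ->
  exists2 i, (1 <= i <= 2 * n)%N & hcell n i x.
Proof.
move=> n1 [x1 xn].
have [p [px xp]] : exists p, INR p <= x < INR p + 1.
  have [h1 h2] := archimed x.
  have u0 : (0 <= up x - 1)%Z by apply: Zlt_succ_le; apply: lt_IZR; rewrite succ_IZR minus_IZR; lra.
  exists (Z.to_nat (up x - 1)); rewrite INR_IZR_INZ Z2Nat.id // minus_IZR; lra.
have p1 : (1 <= p)%N by case: p px xp => //= ? ?; lra.
have pn : (p <= 2 * n + 1)%N.
  by rewrite leqNgt; apply/negP => h; toR h; lra.
have [pl|pl] := leqP p (n + 1).
  exists p; first by lia.
  by rewrite /hcell; do ![case: ifP => ?]; try lra; lia.
(* Cells beyond [n + 1] are open on the left, so from [n + 2] on an integer [p] belongs to the cell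
   [p - 1]; in particular 2n+1 belongs to the last cell. *)
have [xe|xe] := Req_dec x (INR p); last first.
  have : p <> (2 * n + 1)%N by move=> pe; apply: xe; toR pe; lra.
  by exists p; [lia|rewrite /hcell; do ![case: ifP => ?]; lra].
have [q qe] : exists q, p = (q + 1)%N by exists p.-1; lia.
toR qe; exists q; first by lia.
by rewrite /hcell; do ![case: ifP => ?]; try lra; lia.
Qed.

Lemma hcell_dom n i x : (1 <= i <= 2 * n)%N -> hcell n i x -> in_dom n x.
Proof.
by move=> /andP[i1 i2] /hcellP[+ _]; rewrite /cell /in_dom; toR i1; toR i2; lra.
Qed.

Lemma f_n_dom n x : (1 < n)%N -> in_dom n x -> in_dom n (f_n n x).
Proof.
move=> n1 xd; have [i ir ci] := hcell_total _ _ n1 xd.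
have [ce _] := (hcellP n i x).1 ci.
rewrite (f_n_branch _ i) //; toR n1; move: ce xd; rewrite /in_dom /cell.
by case: (branchP n i x n1 ir) => [i1|/andP[i1 i2]|i1|/andP[i1 i2]] ->;
  toR i1; try toR i2; nra.
Qed.

(** A flip exchanges the open and the closed end. This fits because cells from 2 to [n], open on the
    right, go to cells open on the left, and conversely from [n + 2] on; the closed middle cell
    covers itself and the half-open cell [n]. *)
Lemma hcell_step n i x : (1 < n)%N -> (1 <= i <= 2 * n)%N -> hcell n i x ->
  exists2 j, edge n i j & hcell n j (f_n n x).
Proof.
move=> n1 ir hi.
have [ci _] := (hcellP n i x).1 hi.
have fd := f_n_dom _ _ n1 (hcell_dom _ _ _ ir hi).
have [j jr hj] := hcell_total _ _ n1 fd.
move: fd hj; rewrite (f_n_branch _ i) //; toR n1.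
case: (branchP n i x n1 ir) => [i1|/andP[i1 i2]|i1|/andP[i1 i2]] -> fd hj; toR i1; try toR i2.
- exists j => //; rewrite /edge i1 eqxx /=; apply/orP; left; apply/andP; split; last by lia.
  rewrite leqNgt; apply/negP => jn.
  have jn' : (j <= n)%N by lia.
  move: ci hj; rewrite /cell /hcell jn'; toR jn'; nra.
- have [q qe] : exists q, (i + q = 2 * n + 2)%N by exists (2 * n + 2 - i)%N; lia.
  exists q; first by rewrite /edge; lia.
  by move: hi; toR qe; rewrite /hcell; do ![case: ifP => ?]; try lra; lia.
- have [h|h] := Rlt_le_dec (3 * INR n + 4 - 2 * x) (INR n + 1).
    exists n; first by rewrite /edge; lia.
    by move: ci h; rewrite /hcell /cell leqnn; lra.
  exists (n + 1)%N; first by rewrite /edge; lia.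
  move: ci h; rewrite /hcell /cell i1 eqxx INR_addn /=.
  by case: ifP; try lia; lra.
- have [q qe] : exists q, (i + q = 2 * n + 1)%N by exists (2 * n + 1 - i)%N; lia.
  exists q; first by rewrite /edge; lia.
  by move: hi; toR qe; rewrite /hcell; do ![case: ifP => ?]; try lra; lia.
Qed.

(** Wrong ends come only from wrong ends, and only along edges of slope [-1]: the cells [1] and
    [n + 1] send no integer to a wrong end of a successor. *)
Lemma wrong_end_step n i j x : (1 < n)%N -> edge n i j -> cell i x -> is_nat x ->
  wrong_end n j (f_n n x) -> wrong_end n i x /\ (height n j + 1 = height n i)%N.
Proof.
move=> n1 ij ci [p xp]; have /andP[ir jr] := edge_range _ _ _ n1 ij.
rewrite (f_n_branch _ i) // => wj; toR n1.
have : x = INR i \/ x = INR i + 1.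
  move: ci; rewrite /cell xp => -[h1 h2].
  have h3 : (i <= p)%N by apply/leP/INR_le.
  have [->|h4] : (p = i \/ i + 1 <= p)%N by lia.
    by left.
  by toR h4; right; lra.
have key : wrong_end n i x /\ i <> 1%N /\ i <> (n + 1)%N -> 
    wrong_end n i x /\ (height n j + 1 = height n i)%N.
  by case=> ? []; split=> //; apply: height_edge.
move=> xi; apply: key; move: xi wj; rewrite /wrong_end.
case: (branchP n i x n1 ir) => [i1|/andP[i1 i2]|i1|/andP[i1 i2]] ->;
  case/edgeP: ij => [k1 /andP[j1 j2]|/andP[k1 k2] s|k1 /andP[j1 j2]|/andP[k1 k2] s]; try (exfalso; lia).
- toR i1; toR j1; toR j2 => xi [[jn xj]|[jn xj]]; toR jn; exfalso; last first.
    by nra.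
  by lra.
- toR i1; toR i2; toR s => xi [[jn xj]|[jn xj]]; first by lia.
  by split; [left; split=> //; lra | lia].
- toR i1; toR j1; toR j2 => xi [[jn xj]|[jn xj]]; toR jn; exfalso; last first.
    by lra.
  by lra.
- toR i1; toR i2; toR s => xi [[jn xj]|[jn xj]]; last by lia.
  by split; [right; split=> //; lra | lia].
Qed.

Lemma f_n_is_nat n i x : (1 < n)%N -> (1 <= i <= 2 * n)%N -> cell i x ->
  is_nat x -> is_nat (f_n n x).
Proof.
move=> n1 ir ci [p xp]; rewrite (f_n_branch _ i) //.
move: ci; rewrite /cell xp => -[c1 c2].
have p1 : (i <= p)%N by apply/leP/INR_le.
have p2 : (p <= i + 1)%N by apply/leP/INR_le; rewrite INR_addn /=; lra.
case: (branchP n i (INR p) n1 ir) => [i1|/andP[i1 i2]|i1|/andP[i1 i2]] ->.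
- by exists (n * p + 1)%N; rewrite INR_addn INR_muln.
- have [q qe] : exists q, (q + p = 2 * n + 3)%N by exists (2 * n + 3 - p)%N; lia.
  by exists q; toR qe; lra.
- have [q qe] : exists q, (q + 2 * p = 3 * n + 4)%N by exists (3 * n + 4 - 2 * p)%N; lia.
  by exists q; toR qe; lra.
- have [q qe] : exists q, (q + p = 2 * n + 2)%N by exists (2 * n + 2 - p)%N; lia.
  by exists q; toR qe; lra.
Qed.

Lemma itinerary_is_nat n i w x : (1 < n)%N -> path (edge n) i w ->
  itinerary cell (f_n n) i w x -> is_nat x -> is_nat (iterR (size w) (f_n n) x).
Proof.
move=> n1; elim: w i x => // j w IH i x /= /andP[ij pw] [ci it] xn.
rewrite -/(iterR (size w).+1 (f_n n) x) iterR_Sr; apply: IH pw it _.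
by apply: (f_n_is_nat _ i) => //; have /andP[] := edge_range _ _ _ n1 ij.
Qed.

(** Integers are mapped to integers, so a non-integer final point excludes integers, and with them
    wrong ends, all along the orbit. *)
Lemma itinerary_not_nat n i w x : (1 < n)%N -> path (edge n) i w ->
  itinerary cell (f_n n) i w x -> ~ is_nat (iterR (size w) (f_n n) x) ->
  itinerary (hcell n) (f_n n) i w x.
Proof.
move=> n1; elim: w i x => [|j w IH] i x.
  by move=> _ [ci _] nn; split=> //; apply/hcellP; split=> // /wrong_end_is_nat.
move=> pjw it nn; have xn : ~ is_nat x by move=> xn; apply: nn; apply: (itinerary_is_nat _ i).
move: pjw it nn => /= /andP[ij pw] [ci it].
rewrite -/(iterR (size w).+1 (f_n n) x) iterR_Sr => nn; split; last exact: IH.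
by apply/hcellP; split=> // /wrong_end_is_nat.
Qed.

Lemma itinerary_wrong_end n i w x : (1 < n)%N -> path (edge n) i w ->
  itinerary cell (f_n n) i w x -> is_nat x ->
  wrong_end n (last i w) (iterR (size w) (f_n n) x) ->
  wrong_end n i x /\ (height n (last i w) + size w <= height n i)%N.
Proof.
move=> n1; elim: w i x => [|j w IH] i x; first by rewrite /= addn0.
move=> /= /andP[ij pw] [ci it] xn.
rewrite -/(iterR (size w).+1 (f_n n) x) iterR_Sr => we.
have /andP[ir _] := edge_range _ _ _ n1 ij.
have [wj h] := IH _ _ pw it (f_n_is_nat _ _ _ n1 ir ci xn) we.
by have [wi h'] := wrong_end_step _ _ _ _ n1 ij ci xn wj; split=> //; lia.
Qed.

Lemma itinerary_nat n i w x : (1 < n)%N -> path (edge n) i w ->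
  itinerary cell (f_n n) i w x -> is_nat x -> hcell n i x ->
  itinerary (hcell n) (f_n n) i w x.
Proof.
move=> n1; elim: w i x => [|j w IH] i x //= /andP[ij pw] [ci it] xn hi; split=> //.
have /andP[ir _] := edge_range _ _ _ n1 ij.
apply: IH => //; first exact: (f_n_is_nat _ i).
apply/hcellP; split; first exact: itinerary_head it.
by case/(wrong_end_step _ _ _ _ n1 ij ci xn) => wi _; case/hcellP: hi.
Qed.

(* A non-integer orbit never meets an endpoint of a cell, and an integer orbit
   on a wrong endpoint would make [height] decrease forever. *)
Lemma closed_itinerary n i w x : (1 < n)%N -> path (edge n) i w -> last i w = i ->
  w <> [::] -> itinerary cell (f_n n) i w x -> iterR (size w) (f_n n) x = x ->
  itinerary (hcell n) (f_n n) i w x.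
Proof.
move=> n1 pw lw wn it fx; case: (classic (is_nat x)) => xn; last first.
  by apply: itinerary_not_nat => //; rewrite fx.
apply: itinerary_nat => //; apply/hcellP; split; first exact: itinerary_head it.
move=> wi; have := itinerary_wrong_end _ _ _ _ n1 pw it xn.
by rewrite fx lw => /(_ wi)[_]; case: w wn {pw lw it fx} => //= j w _; lia.
Qed.

(** * The bijection between closed walks and fixed points of iterates *)

Lemma fixpoint_closed_walk n k iw : (1 < n)%N -> iw \in closed_walks n k.+1 ->
  itinerary (hcell n) (f_n n) iw.1 iw.2 (fixpoint n iw) /\
  iterR k.+1 (f_n n) (fixpoint n iw) = fixpoint n iw.
Proof.
case: iw => i w n1; rewrite mem_closed_walks // => /and4P[ir /eqP sw pw /eqP lw].
have wn : w <> [::] by move=> w0; rewrite w0 in sw.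
have fx : branches n i w (fixpoint n (i, w)) = fixpoint n (i, w).
  exact/(fixpoint_unique n i w).
have [it e] : itinerary cell (f_n n) i w (fixpoint n (i, w)) /\
    branches n i w (fixpoint n (i, w)) = iterR (size w) (f_n n) (fixpoint n (i, w)).
  by apply: branches_itinerary; rewrite // lw fx; apply: cell_fixpoint.
by rewrite -sw -e fx; split=> //; apply: closed_itinerary; rewrite // -e.
Qed.

(** Half-open cells are disjoint, so a point determines its walk; this makes [fixpoint] injective on
    closed walks. *)
Lemma itinerary_uniq n i j w u x : (1 < n)%N -> size w = size u ->
  itinerary (hcell n) (f_n n) i w x -> itinerary (hcell n) (f_n n) j u x ->
  (i, w) = (j, u).
Proof.
move=> n1; elim: w i j u x => [|i' w IH] i j [|j' u] x //=.
  by move=> _ [hi _] [hj _]; rewrite (hcell_uniq n i j x).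
case=> su [hi iw] [hj ju]; rewrite (hcell_uniq n i j x) //.
by case: (IH _ _ _ _ su iw ju) => -> ->.
Qed.

Lemma itinerary_ex n i k x : (1 < n)%N -> (1 <= i <= 2 * n)%N -> hcell n i x ->
  exists w, [/\ size w = k, path (edge n) i w & itinerary (hcell n) (f_n n) i w x].
Proof.
move=> n1; elim: k i x => [|k IH] i x ir hi; first by exists [::].
have [j ij hj] := hcell_step _ _ _ n1 ir hi.
have /andP[_ jr] := edge_range _ _ _ n1 ij.
have [w [sw pw it]] := IH _ _ jr hj.
by exists (j :: w); split; rewrite /= ?sw ?ij.
Qed.

Lemma sub_itinerary (D D' : nat -> R -> Prop) f i w x :
  (forall j y, D j y -> D' j y) -> itinerary D f i w x -> itinerary D' f i w x.
Proof.
by move=> DD'; elim: w i x => [|j w IH] i x [Di it]; split=> //; [exact: DD'| exact: DD'|exact: IH].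
Qed.

(** The orbit is followed through half-open cells. It returns to [x], whose half-open cell is
    unique, so the walk closes up. *)
Lemma closed_walk_of_fixpoint n k x : (1 < n)%N -> in_dom n x ->
  iterR k.+1 (f_n n) x = x -> exists2 iw, iw \in closed_walks n k.+1 & x = fixpoint n iw.
Proof.
move=> n1 xd fx; have [i ir hi] := hcell_total _ _ n1 xd.
have [w [sw pw it]] := itinerary_ex _ _ k.+1 _ n1 ir hi.
have lw : last i w = i.
  by apply: (hcell_uniq n _ _ x) => //; have := itinerary_last _ _ _ _ _ it; rewrite sw fx.
have wn : w <> [::] by move=> w0; rewrite w0 in sw.
exists (i, w); first by rewrite mem_closed_walks // ir sw pw lw !eqxx.
apply/(fixpoint_unique n i w) => //.
rewrite (itinerary_branches _ _ _ _ n1 pw) ?sw //.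
by apply: sub_itinerary it => j y /hcellP[].
Qed.

(** * Fixed points and periodic orbits as lists of reals *)

Lemma InP (T : eqType) (x : T) (s : seq T) : List.In x s <-> x \in s.
Proof.
elim: s => //= y s IH; rewrite inE IH; split.
  by case=> [->|->]; rewrite ?eqxx ?orbT.
by case/orP => [/eqP ->|]; [left|right].
Qed.

Lemma NoDup_map_inj (T : eqType) (U : Type) (f : T -> U) (s : seq T) : uniq s ->
  {in s &, injective f} -> NoDup (List.map f s).
Proof.
elim: s => [|x s IH] /=; first by move=> _ _; constructor.
case/andP => xs us inj; constructor.
  case/in_map_iff => y [fy /InP ys]; case/negP: xs.
  by rewrite (inj x y) ?inE ?eqxx ?ys ?orbT.
by apply: IH => // y z ys zs; apply: inj; rewrite inE ?ys ?zs orbT.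
Qed.

Definition fixpoints (n k : nat) : list R := List.map (fixpoint n) (closed_walks n k).

Lemma NoDup_fixpoints n k : (1 < n)%N -> NoDup (fixpoints n k.+1).
Proof.
move=> n1; apply: NoDup_map_inj; first exact: uniq_closed_walks.
move=> [i w] [j u] wi uj e.
have [itw _] := fixpoint_closed_walk _ _ _ n1 wi.
have [itu _] := fixpoint_closed_walk _ _ _ n1 uj.
rewrite mem_closed_walks // in wi; rewrite mem_closed_walks // in uj.
case/and4P: wi => _ /eqP sw _ _; case/and4P: uj => _ /eqP su _ _.
by apply: itinerary_uniq itw _ => //; rewrite ?sw ?su // e.
Qed.

Lemma length_fixpoints n k : (1 < n)%N -> length (fixpoints n k.+1) = c k.+1 n.
Proof. by move=> n1; rewrite /fixpoints length_map -size_closed_walks. Qed.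

Lemma In_fixpoints n k x : (1 < n)%N ->
  In x (fixpoints n k.+1) <-> in_dom n x /\ iterR k.+1 (f_n n) x = x.
Proof.
move=> n1; rewrite in_map_iff; split.
  case=> -[i w] [<- /InP iw]; have [it fx] := fixpoint_closed_walk _ _ _ n1 iw.
  split=> //; rewrite mem_closed_walks // in iw; case/and4P: iw => ir _ _ _.
  exact: hcell_dom ir (itinerary_head _ _ _ _ _ it).
by case=> xd /closed_walk_of_fixpoint[]// iw /InP; exists iw.
Qed.

Lemma eqRP : Equality.axiom (fun x y : R => if Req_dec_T x y then true else false).
Proof. by move=> x y; case: Req_dec_T => ?; constructor. Qed.

HB.instance Definition _ := hasDecEq.Build R eqRP.

Lemma NoDupP (T : eqType) (s : seq T) : NoDup s <-> uniq s.
Proof.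
elim: s => [|x s IH] /=; first by split=> // _; constructor.
split.
  by move=> H; inversion H; subst; rewrite (IH.1 _) // andbT; apply/negP => /InP.
by case/andP => xs us; constructor; [move/InP; apply/negP | apply/IH].
Qed.

Lemma iterRE k g x : iterR k g x = iter k g x.
Proof. by elim: k => //= k ->. Qed.

Lemma orbit_listE g x m : orbit_list g x m = traject g x m.
Proof.
(* The start is written as the iterate 0 so that the offset can be generalized in the induction. *)
rewrite /orbit_list -[X in traject g X m]/(iterR 0 g x).
by elim: m 0%N => //= m IH s; rewrite IH.
Qed.

Lemma fixpoints_spec n (n1 : (1 < n)%N) :
  (forall d, (0 < d)%N -> uniq (fixpoints n d) /\ size (fixpoints n d) = c d n) /\
  (forall d e x, (0 < d)%N -> (0 < e)%N -> x \in fixpoints n d ->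
     (x \in fixpoints n e) = (iter e (f_n n) x == x)).
Proof.
split=> [[|d] // _|[|d] [|e] // x _ _].
  by split; [apply/NoDupP/NoDup_fixpoints | apply: length_fixpoints].
move/InP/In_fixpoints => /(_ n1)[xd _].
apply/idP/eqP => [/InP/In_fixpoints|fe]; first by move=> /(_ n1)[_]; rewrite iterRE.
by apply/InP/In_fixpoints => //; rewrite iterRE.
Qed.

Definition aperiodic (n m : nat) : seq R :=
  [seq x <- fixpoints n m | uniq (traject (f_n n) x m)].

Lemma Phi_n_size n m : (1 < n)%N -> (0 < m)%N -> Phi_n n m = Z.of_nat (size (aperiodic n m)).
Proof.
move=> n1 m0; have [FU FM] := fixpoints_spec n n1.
by rewrite size_filter -(Phi_count _ _ _ _ _ m0 FU FM).
Qed.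

Lemma mem_aperiodic n m x : (1 < n)%N -> (0 < m)%N ->
  x \in aperiodic n m <-> in_dom n x /\ minimal_period (f_n n) m x.
Proof.
case: m => // m n1 _; rewrite mem_filter /minimal_period orbit_listE; split.
  by case/andP => ? /InP/In_fixpoints => /(_ n1)[? ?]; split=> //; split=> //; apply/NoDupP.
by case=> xd [fx /NoDupP ->] /=; apply/InP/In_fixpoints.
Qed.

Lemma periodic_orbits n m : (1 < n)%N -> (1 <= m)%N ->
     exists reps : list R,
       NoDup reps /\
       (forall r, In r reps -> in_dom n r /\ minimal_period (f_n n) m r) /\
       (forall x, in_dom n x -> minimal_period (f_n n) m x ->
          exists r, In r reps /\ orbit_rel (f_n n) r x) /\
       (forall r1 r2, In r1 reps -> In r2 reps -> orbit_rel (f_n n) r1 r2 -> r1 = r2) /\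
       INR (length reps) = IZR (Phi_n n m) / INR m.
Proof.
move=> n1 m0; have [FU FM] := fixpoints_spec n n1.
have uL : uniq (aperiodic n m) by rewrite filter_uniq // (FU m m0).1.
have [|reps [ur sub cov dist sz]] := orbit_representatives _ (f_n n) m _ m0 uL.
  move=> x xL; have [xd [fx ox]] := (mem_aperiodic n m x n1 m0).1 xL.
  rewrite orbit_listE in ox; rewrite iterRE in fx; split=> //; last exact/NoDupP.
  apply/mem_aperiodic => //; split; first exact: f_n_dom.
  rewrite /minimal_period iterRE -iterSr iterS fx; split=> //.
  rewrite orbit_listE; apply/NoDupP; move/NoDupP: ox.
  case: m m0 fx {FU FM uL xL} => // m _ fx.
  (* Since the orbit closes up, the trajectory of the image is that of [x] rotated by one place. *)
  by move=> ux; rewrite trajectSr -iterSr fx rcons_uniq.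
exists reps; split; first exact/NoDupP.
split; first by move=> r /InP/sub/mem_aperiodic; apply.
split.
  move=> x xd mx; have [|r rr [j e]] := cov x; first exact/mem_aperiodic.
  by exists r; split; [exact/InP | exists j; rewrite iterRE].
split.
  by move=> r s /InP rr /InP ss [j e]; apply: dist => //; exists j; rewrite -iterRE.
rewrite (Phi_n_size n m n1 m0) -INR_IZR_INZ -sz INR_muln -[length _]/(size reps).
by field; toR m0; lra.
Qed.

Lemma c_le_Phi_n n m : (1 < n)%N -> (0 < m)%N ->
  INR (c m n) <= IZR (Phi_n n m) + INR (\sum_(1 <= d < m./2.+1) c d n)%N.
Proof.
move=> n1 m0; have [FU FM] := fixpoints_spec n n1.
rewrite (Phi_n_size n m n1 m0) -INR_IZR_INZ -INR_addn size_filter.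
by apply: leR; apply: (count_aperiodic _ _ _ (fun d => c d n)).
Qed.

Lemma Phi_n_le_c n m : (1 < n)%N -> (0 < m)%N -> IZR (Phi_n n m) <= INR (c m n).
Proof.
move=> n1 m0; have [FU FM] := fixpoints_spec n n1.
rewrite (Phi_n_size n m n1 m0) -INR_IZR_INZ -(FU m m0).2.
by apply: leR; rewrite size_filter count_size.
Qed.

(** * The polynomial and its zeros *)

Lemma P_nE n x : (1 < n)%N -> P_n n x = x ^ (2 * n - 1) * (x * x - 2) - 1.
Proof.
move=> n1; rewrite /P_n (_ : (2 * n + 1)%N = (2 * n - 1).+2); last by lia.
by rewrite /=; ring.
Qed.

(** At a positive zero x^2 - 2 is positive, and from there on both factors of x^(2n-1) (x^2 - 2)
    increase. *)
Lemma P_n_incr n x y : (1 < n)%N -> 0 < x -> P_n n x = 0 -> x < y -> 0 < P_n n y.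
Proof.
move=> n1 x0; rewrite !P_nE // => Px xy.
have xk : 0 < x ^ (2 * n - 1) by apply: pow_lt.
have xyk : x ^ (2 * n - 1) <= y ^ (2 * n - 1) by apply: pow_incr; lra.
have x2 : 0 < x * x - 2 by nra.
have xy2 : x * x - 2 < y * y - 2 by nra.
nra.
Qed.

Lemma P_n_root n : (1 < n)%N -> exists2 l, 0 < l & P_n n l = 0.
Proof.
move=> n1; have cP : continuity (P_n n).
  apply: continuity_minus; last by apply: continuity_const => x y.
  apply: continuity_minus; first exact: derivable_continuous (derivable_pow _).
  exact: continuity_scal (derivable_continuous _ (derivable_pow _)).
(* The values at 1 and 2 are -2 and 2^(2n) - 1. *)
have [||] := IVT (P_n n) 1 2 cP ltac:(lra).
- by rewrite P_nE // pow1; lra.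
- by rewrite P_nE //; have := pow_R1_Rle 2 (2 * n - 1) ltac:(lra); lra.
- by move=> l [l12 Pl]; exists l; lra.
Qed.

Lemma P_n_root_gt n l : (1 < n)%N -> 0 < l -> P_n n l = 0 -> 1 < l /\ 2 < l * l.
Proof.
move=> n1 l0; rewrite P_nE // => Pl.
have lk : 0 < l ^ (2 * n - 1) by apply: pow_lt.
have l2 : 2 < l * l by apply: Rnot_le_lt => h; nra.
by split=> //; nra.
Qed.

Lemma P_n_root_uniq n l y : (1 < n)%N -> 0 < l -> P_n n l = 0 -> 0 < y -> P_n n y = 0 -> y = l.
Proof.
move=> n1 l0 Pl y0 Py; case: (Rtotal_order y l) => [h|[//|h]].
  by have := P_n_incr _ _ _ n1 y0 Py h; lra.
by have := P_n_incr _ _ _ n1 l0 Pl h; lra.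
Qed.

Definition normC2 (z : R * R) : R := fst z * fst z + snd z * snd z.

Lemma normC2_Cpow z k : normC2 (Cpow z k) = normC2 z ^ k.
Proof. by elim: k => [|k IH]; rewrite /= -?IH /normC2 /=; ring. Qed.

Lemma Cpow_real x k : Cpow (x, 0) k = (x ^ k, 0).
Proof. by elim: k => //= k ->; rewrite /Cmul /=; congr pair; ring. Qed.

(* Writing the equation as [z^(2n-1) (z^2 - 2) = 1], a root with [|z| >= l] gives
   [|z^2 - 2| = |z|^2 - 2], the equality case of the triangle inequality. *)
Lemma P_n_C_root n l z : (1 < n)%N -> 0 < l -> P_n n l = 0 ->
  P_n_C n z = (0, 0) -> z <> (l, 0) -> Cabs z < l.
Proof.
move=> n1 l0 Pl; rewrite /P_n_C (_ : (2 * n + 1)%N = (2 * n - 1).+2); last by lia.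
case: z => x y Pz zl; apply: Rnot_le_lt => lz; apply: zl.
have [l1 l2] := P_n_root_gt _ _ n1 l0 Pl.
set r := Cabs (x, y) in lz.
have rr : r * r = x * x + y * y by apply: sqrt_sqrt; rewrite /=; nra.
have nw := normC2_Cpow (x, y) (2 * n - 1).
have {}nw : normC2 (Cpow (x, y) (2 * n - 1)) = r ^ (2 * n - 1) * r ^ (2 * n - 1).
  by rewrite nw /normC2 /= -rr Rpow_mult_distr.
case E : (Cpow (x, y) (2 * n - 1)) nw Pz => [w1 w2]; rewrite /normC2 /= E /= => nw Pz.
case: Pz => e1 e2.
set a := x * x - y * y; set bb := 2 * x * y.
have {}e1 : (a - 2) * w1 - bb * w2 = 1 by rewrite /a /bb; lra.
have {}e2 : (a - 2) * w2 + bb * w1 = 0 by rewrite /a /bb; lra.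
have prod1 : ((a - 2) * (a - 2) + bb * bb) * (w1 * w1 + w2 * w2) = 1.
  have -> : ((a - 2) * (a - 2) + bb * bb) * (w1 * w1 + w2 * w2) =
    ((a - 2) * w1 - bb * w2) * ((a - 2) * w1 - bb * w2) +
    ((a - 2) * w2 + bb * w1) * ((a - 2) * w2 + bb * w1) by ring.
  by rewrite e1 e2; ring.
set q := r * r in rr.
(* The term 8y^2 is the defect in |z^2 - 2| >= |z|^2 - 2; it has to vanish once |z| = l. *)
have uE : (a - 2) * (a - 2) + bb * bb = (q - 2) * (q - 2) + 8 * (y * y).
  by rewrite rr /a /bb; ring.
have rk : 0 < r ^ (2 * n - 1) by apply: pow_lt; lra.
set k := r ^ (2 * n - 1) in nw rk.
have q2 : 2 < q by rewrite /q; nra.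
have kq : k * (q - 2) <= 1.
  have : (k * (q - 2)) * (k * (q - 2)) <= 1 by rewrite -prod1 nw uE; nra.
  have : 0 < k * (q - 2) by nra.
  by nra.
have rl : r = l.
  apply: Rle_antisym => //; apply: Rnot_lt_le => lr.
  have := P_n_incr _ _ _ n1 l0 Pl lr.
  by rewrite P_nE // -/k -/q; lra.
have kq1 : k * (q - 2) = 1.
  by move: Pl; rewrite -rl P_nE // -/k -/q; lra.
have y0 : y = 0.
  have : k * k * (8 * (y * y)) = 0.
    have : k * (q - 2) * (k * (q - 2)) + k * k * (8 * (y * y)) = 1.
      by rewrite -prod1 nw uE; ring.
    by rewrite kq1; lra.
  case/Rmult_integral => h; last by apply: Rsqr_0_uniq; rewrite /Rsqr; lra.
  by have := Rmult_lt_0_compat _ _ rk rk; lra.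
rewrite y0 in E rr *; rewrite Cpow_real in E; case: E => xw w20.
have xx : x * x = l * l by rewrite -rl -/q rr; ring.
(* It remains to exclude x = -l: the exponent 2n - 1 is odd, so x^(2n-1) (x^2 - 2) = 1 forces [x] to
   be positive. *)
have xpos : 0 < x.
  have kE : (2 * n - 1)%N = (2 * (n - 1)).+1 by lia.
  have : w1 * (q - 2) = 1 by rewrite -e1 -w20 /a rr y0; ring.
  rewrite -xw kE -tech_pow_Rmult -multE pow_mult.
  have -> : x ^ 2 = l * l by rewrite -xx; ring.
  have : 0 < (l * l) ^ (n - 1) by apply: pow_lt; nra.
  move=> h1 h2; apply: Rnot_le_lt => h3.
  by have h4 := Rmult_lt_0_compat _ (q - 2) h1 ltac:(lra); nra.
by congr pair; nra.
Qed.

(** * Growth rate *)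

(* Left eigenvector, for the eigenvalue [l], of the matrix of the recursion
   defining [b]. *)
Definition weight (n : nat) (l : R) (j : nat) : R :=
  if (j <= n)%N then l ^ (2 * n + 1) + l ^ (2 * j)
  else if j == (n + 1)%N then l ^ (2 * n) * (l * l - 1)
  else (l ^ (2 * n + 1) + l ^ (2 * (2 * n + 2 - j))) / l.

Lemma weight_low n l j : 0 < l -> (1 <= j < n)%N ->
  weight n l (2 * n + 1 - j) + weight n l (n + 1) = l * weight n l j.
Proof.
move=> l0 jn; rewrite /weight eqxx.
do ![case: ifP => ?]; try (exfalso; lia).
have -> : (2 * (2 * n + 2 - (2 * n + 1 - j)) = (2 * j).+2)%N by lia.
have -> : (2 * n + 1 = (2 * n).+1)%N by lia.
by rewrite /=; field; lra.
Qed.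

Lemma weight_n n l : 0 < l -> weight n l n + weight n l (n + 1) = l * weight n l n.
Proof.
move=> l0; rewrite /weight eqxx.
do ![case: ifP => ?]; try (exfalso; lia).
have -> : (2 * n + 1 = (2 * n).+1)%N by lia.
by rewrite /=; ring.
Qed.

Lemma weight_high n l j : 0 < l -> (n + 2 <= j <= 2 * n)%N ->
  weight n l (2 * n + 2 - j) = l * weight n l j.
Proof.
move=> l0 jn; rewrite /weight; do ![case: ifP => ?]; try (exfalso; lia).
by field; lra.
Qed.

(** This eigenvector equation is where the polynomial enters: it amounts to l^2 = l^(2n+1) (l^2 -
    2). *)
Lemma weight_1 n l : (1 < n)%N -> 0 < l -> P_n n l = 0 ->
  weight n l 1 = l * weight n l (n + 1).
Proof.
move=> n1 l0; rewrite P_nE // /weight eqxx => Pl; do ![case: ifP => ?]; try (exfalso; lia).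
have -> : (2 * n + 1 = (2 * n - 1).+2)%N by lia.
have -> : (2 * n = (2 * n - 1).+1)%N by lia.
rewrite subSS subn0 muln1 /=; set t := l ^ (2 * n - 1) in Pl *.
have -> : l * (l * 1) = l * l * (t * (l * l - 2)) by rewrite (_ : t * (l * l - 2) = 1); [ring|lra].
by ring.
Qed.

Lemma weight_bounds n l j : (1 < n)%N -> 0 < l -> P_n n l = 0 -> (1 <= j <= 2 * n)%N ->
  1 <= weight n l j <= 2 * l ^ (2 * n + 2).
Proof.
move=> n1 l0 Pl jr; have [l1 l2] := P_n_root_gt _ _ n1 l0 Pl.
have pw a : 1 <= l ^ a by apply: pow_R1_Rle; lra.
have mono a a' : (a <= a')%N -> l ^ a <= l ^ a' by move/leP; apply: Rle_pow; lra.
have e1 : l ^ (2 * n + 1) = l * l ^ (2 * n) by rewrite addn1.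
have e2 : l ^ (2 * n + 2) = l * (l * l ^ (2 * n)) by rewrite addn2.
have p0 := pw (2 * n)%N.
have low a : (a <= 2 * n)%N -> 1 <= l ^ (2 * n + 1) + l ^ a <= 2 * l ^ (2 * n + 1).
  move=> an; have := pw a; have := pw (2 * n + 1)%N.
  by have := mono a (2 * n + 1)%N ltac:(lia); lra.
have up : l ^ (2 * n + 1) <= l ^ (2 * n + 2) by apply: mono; lia.
rewrite /weight; case: ifP => jn; [|case: ifP => jn1].
- by have := low (2 * j)%N ltac:(lia); lra.
- by rewrite e2; nra.
- have := low (2 * (2 * n + 2 - j))%N ltac:(lia); set a := l ^ (2 * (_ - _)) => -[h1 h2].
  have aq : 1 <= a by apply: pw.
  have e3 : (l ^ (2 * n + 1) + a) / l = l ^ (2 * n) + a / l by rewrite e1; field; lra.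
  have a1 : 0 < a / l by apply: Rdiv_lt_0_compat; lra.
  have a2 : a / l <= a by rewrite -[X in _ <= X]Rmult_1_r; apply: Rmult_le_compat_l; [lra|rewrite -Rinv_1; apply: Rinv_le_contravar; lra].
  rewrite e3; split; first lra.
  by have := mono (2 * n)%N (2 * n + 2)%N ltac:(lia); lra.
Qed.

(** Weights obey the recursion of [b] up to a factor [l], so the bound propagates; it starts from
    entries at most 1 and weights at least 1. *)
Lemma b_upper n l i j k : (1 < n)%N -> 0 < l -> P_n n l = 0 -> (1 <= j <= 2 * n)%N ->
  INR (b k.+1 i j n) <= l ^ k.+1 * weight n l j.
Proof.
move=> n1 l0 Pl; have [l1 l2] := P_n_root_gt _ _ n1 l0 Pl.
elim: k j => [|k IH] j jr.
  have [w1 _] := weight_bounds _ _ _ n1 l0 Pl jr.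
  have : INR (b 1 i j n) <= INR 1 by apply: leR; rewrite /b /b1; case: (_ || _).
  by rewrite /=; nra.
have pk : l ^ k.+2 = l ^ k.+1 * l by rewrite /=; ring.
rewrite pk Rmult_assoc.
have [jl|[jn|[jn|jh]]] : (1 <= j < n \/ j = n \/ j = n + 1 \/ n + 2 <= j <= 2 * n)%N by lia.
- rewrite bS_low // -weight_low // INR_addn Rmult_plus_distr_l.
  by apply: Rplus_le_compat; apply: IH; lia.
- rewrite jn bS_n // -weight_n // INR_addn Rmult_plus_distr_l.
  by apply: Rplus_le_compat; apply: IH; lia.
- by rewrite jn bS_n1 // -weight_1 //; apply: IH; lia.
- by rewrite bS_high // -weight_high //; apply: IH; lia.
Qed.

(** The conditional counts the recursion steps from [j] to [n], following first summands. Row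
    [n + 1] starts with a 1 at [n], and index [n] feeds itself, so positivity persists. *)
Lemma b_pos n j k : (1 < n)%N -> (1 <= j <= 2 * n)%N ->
  ((if j <= n then 2 * (n - j) else if j == n + 1 then 2 * n - 1 else 2 * (j - n - 2) + 1) <= k)%N ->
  (1 <= b k.+1 (n + 1) j n)%N.
Proof.
move=> n1; elim: k j => [|k IH] j jr.
  move=> h; have -> : j = n by move: h; do ![case: ifP => ?]; lia.
  by rewrite /b /b1; lia.
have [jl|[->|[->|jh]]] : (1 <= j < n \/ j = n \/ j = n + 1 \/ n + 2 <= j <= 2 * n)%N by lia.
- move=> h; rewrite bS_low //; apply: leq_trans (leq_addr _ _); apply: IH; first by lia.
  by move: h; do ![case: ifP => ?]; lia.
- move=> _; rewrite bS_n //; apply: leq_trans (leq_addr _ _); apply: IH; first by lia.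
  by rewrite leqnn; lia.
- move=> h; rewrite bS_n1 //; apply: IH; first by lia.
  by move: h; do ![case: ifP => ?]; lia.
- move=> h; rewrite bS_high //; apply: IH; first by lia.
  by move: h; do ![case: ifP => ?]; lia.
Qed.

Lemma b_lower n l j k : (1 < n)%N -> 0 < l -> P_n n l = 0 -> (1 <= j <= 2 * n)%N ->
  l ^ k * weight n l j <= 2 * l ^ (2 * n + 2) * INR (b (2 * n + k) (n + 1) j n).
Proof.
move=> n1 l0 Pl; have [l1 l2] := P_n_root_gt _ _ n1 l0 Pl.
set M := 2 * _; have nS : (2 * n = (2 * n - 1).+1)%N by lia.
elim: k j => [|k IH] j jr.
  have [w1 w2] := weight_bounds _ _ _ n1 l0 Pl jr.
  (* The largest step count in [b_pos] is 2n - 1, at j = n + 1, so by index 2n the whole row is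
     positive. *)
  have b1 : 1 <= INR (b (2 * n + 0) (n + 1) j n).
    rewrite addn0 nS; apply: (leR 1); apply: b_pos => //.
    by do ![case: ifP => ?]; lia.
  by rewrite /= -/M in w2 *; nra.
have pk : l ^ k.+1 = l ^ k * l by rewrite /=; ring.
rewrite pk Rmult_assoc addnS; move: IH; rewrite nS addSn -nS => IH.
have [jl|[->|[->|jh]]] : (1 <= j < n \/ j = n \/ j = n + 1 \/ n + 2 <= j <= 2 * n)%N by lia.
- rewrite bS_low // -weight_low // INR_addn !Rmult_plus_distr_l.
  by apply: Rplus_le_compat; apply: IH; lia.
- rewrite bS_n // -weight_n // INR_addn !Rmult_plus_distr_l.
  by apply: Rplus_le_compat; apply: IH; lia.
- by rewrite bS_n1 // -weight_1 //; apply: IH; lia.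
- by rewrite bS_high // -weight_high //; apply: IH; lia.
Qed.

Lemma INR_sum_le (I : eqType) (r : seq I) (F : I -> nat) (B : R) :
  {in r, forall i, INR (F i) <= B} -> INR (\sum_(i <- r) F i)%N <= INR (size r) * B.
Proof.
elim: r => [|i r IH] H; first by rewrite big_nil /=; lra.
rewrite big_cons INR_addn [size _]/= S_INR.
have := H i (mem_head _ _); have := IH (fun j jr => H j (mem_behead (s := i :: r) jr)).
by lra.
Qed.

Lemma c_upper n l : (1 < n)%N -> 0 < l -> P_n n l = 0 ->
  exists2 C, 0 < C & forall k, (0 < k)%N -> INR (c k n) <= C * l ^ k.
Proof.
move=> n1 l0 Pl; have [l1 _] := P_n_root_gt _ _ n1 l0 Pl.
set M := 2 * l ^ (2 * n + 2).
have M0 : 0 < M by have := pow_lt l (2 * n + 2) l0; rewrite /M; lra.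
(* [c] has 2n + 1 + (n - 1) = 3n summands, each at most M l^k. *)
toR n1; exists (3 * INR n * M); first by nra.
move=> [|k] // _; have lk := pow_lt l k.+1 l0.
have bB i j : (1 <= j <= 2 * n)%N -> INR (b k.+1 i j n) <= M * l ^ k.+1.
  move=> jr; have := b_upper _ _ i _ k n1 l0 Pl jr.
  by have [_ ] := weight_bounds _ _ _ n1 l0 Pl jr; rewrite -/M; nra.
rewrite /c 2!INR_addn.
have h1 : INR (\sum_(1 <= i < 2 * n + 1) b k.+1 i i n)%N <= 2 * INR n * (M * l ^ k.+1).
  have -> : 2 * INR n = INR (size (index_iota 1 (2 * n + 1))) by rewrite size_iota addn1 subn1 INR_muln.
  by apply: INR_sum_le => i; rewrite mem_index_iota => ir; apply: bB; lia.
have h2 : INR (\sum_(n + 2 <= i < 2 * n + 1) b k.+1 i (n + 1) n)%N <= (INR n - 1) * (M * l ^ k.+1).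
  have -> : INR n - 1 = INR (size (index_iota (n + 2) (2 * n + 1))).
    have sz : (size (index_iota (n + 2) (2 * n + 1)) + 1 = n)%N by rewrite size_iota; lia.
    by rewrite -{1}sz INR_addn /=; ring.
  by apply: INR_sum_le => i _; apply: bB; lia.
by have := bB (n + 1)%N n ltac:(lia); lra.
Qed.

Lemma c_lower n l : (1 < n)%N -> 0 < l -> P_n n l = 0 ->
  exists2 C, 0 < C & forall k, (2 * n <= k)%N -> C * l ^ k <= INR (c k n).
Proof.
move=> n1 l0 Pl; have [l1 _] := P_n_root_gt _ _ n1 l0 Pl.
set M := 2 * l ^ (2 * n + 2).
have M0 : 0 < M by have := pow_lt l (2 * n + 2) l0; rewrite /M; lra.
have p0 := pow_lt l (2 * n) l0.
(* [M] is the constant of [b_lower], and l^(2n) accounts for the shift from [k] to [q]. Only the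
   diagonal term at [n + 1] is kept. *)
exists (/ (M * l ^ (2 * n))); first by apply: Rinv_0_lt_compat; nra.
move=> k /subnKC <-; set q := (k - 2 * n)%N.
have jr : (1 <= n + 1 <= 2 * n)%N by lia.
have := b_lower _ _ _ q n1 l0 Pl jr; rewrite -/M => bl.
have [w1 _] := weight_bounds _ _ _ n1 l0 Pl jr.
have q0 := pow_lt l q l0.
apply: (Rle_trans _ (INR (b (2 * n + q) (n + 1) (n + 1) n))).
  have -> : / (M * l ^ (2 * n)) * l ^ (2 * n + q) = l ^ q / M.
    by rewrite -plusE pow_add; field; lra.
  by apply: (Rmult_le_reg_l M) => //; rewrite (_ : M * (l ^ q / M) = l ^ q); [nra|field; lra].
apply: leR; rewrite /c -addnA; apply: leq_trans (leq_addr _ _).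
by rewrite (big_rem (n + 1)%N) ?mem_index_iota /= ?leq_addr //; lia.
Qed.

(** Bernoulli's inequality for s = sqrt l gives s^p >= p(s - 1); squaring it bounds l^p below by a
    quadratic in [p]. *)
Lemma linear_le_pow (A l : R) : 1 < l -> exists N, forall p, (N <= p)%N -> A * INR p <= l ^ p.
Proof.
move=> l1; set s := sqrt l.
have ss : s * s = l by apply: sqrt_sqrt; lra.
have s1 : 0 < s - 1 by have := sqrt_lt_1 1 l ltac:(lra) ltac:(lra) l1; rewrite sqrt_1 -/s; lra.
have [N hN] := INR_unbounded (A / ((s - 1) * (s - 1))).
exists N => p Np; toR Np.
have hp : A <= INR p * ((s - 1) * (s - 1)).
  have d0 : 0 < (s - 1) * (s - 1) by nra.
  rewrite -[A in A <= _](_ : A / ((s - 1) * (s - 1)) * ((s - 1) * (s - 1)) = A); last by field; lra.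
  by apply: Rmult_le_compat_r; lra.
have := poly p _ s1; rewrite (_ : 1 + (s - 1) = s); last by ring.
have p0 := pos_INR p.
rewrite -ss Rpow_mult_distr => h.
have : (INR p * (s - 1)) * (INR p * (s - 1)) <= s ^ p * s ^ p by apply: Rmult_le_compat; nra.
by nra.
Qed.

Lemma Phi_n_growth n l : (1 < n)%N -> 0 < l -> P_n n l = 0 ->
  exists a1 a2 m0, [/\ 0 < a1, 0 < a2 &
    forall m, (m0 <= m)%N -> (0 < m)%N -> a1 * l ^ m <= IZR (Phi_n n m) <= a2 * l ^ m].
Proof.
move=> n1 l0 Pl; have [l1 _] := P_n_root_gt _ _ n1 l0 Pl.
have [C C0 hC] := c_upper _ _ n1 l0 Pl.
have [D D0 hD] := c_lower _ _ n1 l0 Pl.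
(* Applied to p = m - h with h = m/2 rounded down, this bounds the proper divisors' share h C l^h by
   half of D l^m. *)
have [N hN] := linear_le_pow (4 * C / D) l l1.
(* The summand [2 * n] serves [c_lower], and [2 * N] ensures p >= N. *)
exists (D / 2), C, (2 * n + 2 * N)%N; split=> // [|m mN m0]; first by lra.
split; last by apply: Rle_trans (Phi_n_le_c n m n1 m0) (hC m m0).
have lo := hD m ltac:(lia).
have Pc := c_le_Phi_n n m n1 m0.
set h := m./2; set p := (m - h)%N.
have mE : m = (h + p)%N by rewrite /p /h; lia.
have hp : (h <= p)%N by rewrite /p /h; lia.
have Np : (N <= p)%N by rewrite /p /h; lia.
have lh := pow_lt l h l0.
have sum : INR (\sum_(1 <= d < h.+1) c d n)%N <= INR h * (C * l ^ h).
  have -> : INR h = INR (size (index_iota 1 h.+1)) by rewrite size_iota subSS subn0.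
  apply: INR_sum_le => d; rewrite mem_index_iota => /andP[d1 dh].
  apply: Rle_trans (hC d d1) _; apply: Rmult_le_compat_l; first lra.
  by apply: Rle_pow; [lra|apply/leP].
have hh : INR h * (C * l ^ h) <= D / 2 * l ^ m.
  have := hN p Np => lp; toR hp.
  have : 4 * C * INR p <= D * l ^ p.
    apply: (Rmult_le_reg_l (/ D)); first exact: Rinv_0_lt_compat.
    by rewrite (_ : / D * (D * l ^ p) = l ^ p); [move: lp; rewrite /Rdiv; lra|field; lra].
  have : l ^ m = l ^ h * l ^ p by rewrite mE -plusE pow_add.
  move=> -> h4.
  have : C * INR h <= D / 2 * l ^ p by have := pos_INR h; nra.
  by nra.
by move: sum hh Pc lo; rewrite -/h; lra.
Qed.

Lemma ln_le_ln (x y : R) : 0 < x -> x <= y -> ln x <= ln y.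
Proof. by move=> x0 [xy|->]; [left; apply: ln_increasing|right]. Qed.

(** The logarithm of [u m] differs from m ln l by at most a constant K, and ln m <= 2 sqrt m, so
    after division by [m] the error is of order 1/sqrt m. *)
Lemma growth_rate (u : nat -> R) (l a1 a2 : R) (m0 : nat) : 0 < l -> 0 < a1 -> 0 < a2 ->
  (forall m, (m0 <= m)%N -> (0 < m)%N -> a1 * l ^ m <= u m <= a2 * l ^ m) ->
  Un_cv (fun m => ln (u (S m) / INR (S m)) / INR (S m)) (ln l).
Proof.
move=> l0 a10 a20 hu eps eps0.
set K := Rabs (ln a1) + Rabs (ln a2).
(* The square appears because [t] below is the square root of the index: t > (K + 2)/eps gives K +
   2t <= (K + 2)t < eps t^2. *)
have [N hN] := INR_unbounded (((K + 2) / eps) * ((K + 2) / eps)).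
exists (m0 + N)%N => m /leP mN; set M := S m.
have [u1 u2] := hu M ltac:(lia) isT.
have lM := pow_lt l M l0.
have M1 : 1 <= INR M by apply: (leR 1).
have NM : INR N <= INR M by apply: leR; rewrite /M; lia.
set t := sqrt (INR M).
have tt : t * t = INR M by apply: sqrt_sqrt; lra.
have t1 : 1 <= t by rewrite -sqrt_1; apply: sqrt_le_1; lra.
have lnM : 0 <= ln (INR M) <= 2 * t.
  split; first by rewrite -ln_1; apply: ln_le_ln; lra.
  have -> : ln (INR M) = 2 * ln t by rewrite -tt ln_mult; lra.
  have := exp_ineq1_le (ln t); rewrite exp_ln; lra.
have u0 : 0 < u M by nra.
have e : ln (u M / INR M) = ln (u M) - ln (INR M).
  by rewrite /Rdiv ln_mult ?ln_Rinv; try lra; apply: Rinv_0_lt_compat; lra.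
have lnl : ln (l ^ M) = INR M * ln l by apply: ln_pow.
have lo : ln a1 + INR M * ln l <= ln (u M).
  by rewrite -lnl -ln_mult //; apply: ln_le_ln => //; nra.
have hi : ln (u M) <= ln a2 + INR M * ln l.
  by rewrite -lnl -ln_mult //; apply: ln_le_ln.
have [k1 k2] : - K <= ln a1 /\ ln a2 <= K.
  have := Rle_abs (ln a2); have := Rle_abs (- ln a1); rewrite Rabs_Ropp /K.
  by have := Rabs_pos (ln a1); have := Rabs_pos (ln a2); lra.
have K0 : 0 <= K by have := Rabs_pos (ln a1); have := Rabs_pos (ln a2); rewrite /K; lra.
have tK : K + 2 < eps * t.
  set r := (K + 2) / eps in hN.
  have rE : K + 2 = eps * r by rewrite /r; field; lra.
  have r0 : 0 < r by apply: Rdiv_lt_0_compat; lra.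
  by rewrite rE; apply: Rmult_lt_compat_l => //; nra.
have big : K + 2 * t < eps * INR M by rewrite -tt; nra.
have vE : ln (u M / INR M) / INR M - ln l =
    (ln (u M) - INR M * ln l - ln (INR M)) / INR M by rewrite e; field; lra.
rewrite /R_dist vE; apply: Rabs_def1; apply: (Rmult_lt_reg_r (INR M)); try lra.
- by rewrite /Rdiv Rmult_assoc Rinv_l; lra.
- by rewrite /Rdiv Rmult_assoc Rinv_l; lra.
Qed.

Theorem theorem2 (n : nat) (hn : (1 < n)%N) :
  (* (a) *)
  (forall k : nat, (1 <= k)%N ->
     exists sols : list R,
       NoDup sols /\ length sols = c k n /\
       (forall x, In x sols <-> (in_dom n x /\ iterR k (f_n n) x = x)))
  /\
  (* (b) *)
  (forall m : nat, (1 <= m)%N ->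
     exists reps : list R,
       NoDup reps /\
       (forall r, In r reps -> in_dom n r /\ minimal_period (f_n n) m r) /\
       (forall x, in_dom n x -> minimal_period (f_n n) m x ->
          exists r, In r reps /\ orbit_rel (f_n n) r x) /\
       (forall r1 r2, In r1 reps -> In r2 reps -> orbit_rel (f_n n) r1 r2 -> r1 = r2) /\
       INR (length reps) = IZR (Phi_n n m) / INR m)
  /\
  (* (c) *)
  (exists lam : R,
     0 < lam /\ P_n n lam = 0 /\
     (forall y, 0 < y -> P_n n y = 0 -> y = lam) /\
     (forall z : R * R, P_n_C n z = (0, 0) -> z <> (lam, 0) -> Cabs z < lam) /\
     Un_cv (fun m => ln (IZR (Phi_n n (S m)) / INR (S m)) / INR (S m)) (ln lam)).
Proof.
split; [|split].
- move=> [|k] // _; exists (fixpoints n k.+1).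
  split; first exact: NoDup_fixpoints.
  by split=> [|x]; [exact: length_fixpoints | exact: In_fixpoints].
- by move=> m m0; apply: periodic_orbits.
- have [l l0 Pl] := P_n_root n hn; exists l; do 3 split=> //; last split.
  + by move=> y; apply: P_n_root_uniq.
  + by move=> z; apply: P_n_C_root.
  + have [a1 [a2 [m0 [a10 a20 H]]]] := Phi_n_growth n l hn l0 Pl.
    exact: (growth_rate (fun m => IZR (Phi_n n m)) l a1 a2 m0).
Qed.
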